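(* For every $k\in\{0,1,2,\ldots\}\cup\{\infty\}$ one has $\mathcal D^{k}_{\rm Seip}=\mathcal D^{k}_{\rm BGN}(\mathcal D^{0}_{\rm Seip},\mathbb R)$; i.e. a triple $\tilde f=(E,F,f)$ belongs to $\mathcal D^k_{\rm Seip}$ if and only if it is $k$-th order $\mathcal D^0_{\rm Seip}$-BGN-differentiable over $\mathbb R$.
   Context: Spaces. ''Compact'' means every open cover has a finite subcover (no Hausdorff requirement). For a topology $\mathcal T$ on a set $X$, its Kelleyfication $k\mathcal T$ is the set of all $U\subseteq X$ such that for every $\mathcal T$-compact $K$ there is $V\in\mathcal T$ with $U\cap K=V\cap K$. $\mathcal T$ is compactly generated if it is Hausdorff and $k\mathcal T=\mathcal T$. For topologies $\mathcal T,\mathcal U$ put $\mathcal T\times_k\mathcal U=k(\mathcal T\times\mathcal U)$, with $\mathcal T\times\mathcal U$ the usual product topology. A real topologized vector space $E$ is a real vector space with a topology $\tau_E$ on its underlying set (no compatibility required). $\mathrm{cgVS}$ is the class of real topologized vector spaces $E$ with $\tau_E$ compactly generated, addition continuous $\tau_E\times_k\tau_E\to\tau_E$, and scalar multiplication continuous $\tau_{\mathbb R}\times\tau_E\to\tau_E$. $\mathrm{scgVS}$ (Seip-convenient spaces) is the class of $E\in\mathrm{cgVS}$ such that there is a topology $\mathcal U$ on $E$ making it a sequentially complete Hausdorff locally convex space with $\tau_E=k\,\mathcal U$. For $E,F\in\mathrm{scgVS}$, $E\sqcap_k F$ is the product vector space with topology $\tau_E\times_k\tau_F$. Maps. A partial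 function $f$ from $E$ to $F$ is a function with $\mathrm{dom}\,f\subseteq E$ and values in $F$. $\mathcal C_0$ is the class of triples $(E,F,f)$ with $E,F\in\mathrm{scgVS}$, $f$ a partial function from $E$ to $F$, and $f^{-1}[V]\in\tau_E$ for all $V\in\tau_F$ (i.e. $f$ is continuous with open domain). Seip classes. For $\tilde f=(E,F,f)$ with $E,F\in\mathrm{scgVS}$ and $f$ a partial function with open domain, the Seip-variation is $\delta\tilde f=(E\sqcap_kE,F,g)$, where $g$ is the function with $g(x,u)=\lim_{0\ne t\to0}t^{-1}(f(x+tu)-f(x))$ (limit in $\tau_F$), defined at exactly those $(x,u)\in\mathrm{dom}\,f\times E$ for which the limit exists. $\tilde f$ is Seip differentiable if $\tilde f,\delta\tilde f\in\mathcal C_0$ and $\mathrm{dom}\,f\times E\subseteq\mathrm{dom}\,g$. For $k\in\{0,1,\ldots\}\cup\{\infty\}$, $\mathcal D^k_{\rm Seip}$ is the class of $\tilde f$ for which there is a sequence $(\tilde f_i)$ of members of $\mathcal C_0$, indexed by $0\le i\le k$ (all $i\in\{0,1,\ldots\}$ if $k=\infty$), with $\tilde f_0=\tilde f$ and, for all finite $i<k$, $\tilde f_i$ Seip differentiable and $\tilde f_{i+1}=\delta\tilde f_i$. In particular $\mathcal D^0_{\rm Seip}=\mathcal C_0$. BGN classes for $\mathcal C_0$ over $\mathbb R$. For $\tilde f=(E,F,f)\in\mathcal C_0$, a first order BGN-difference quotient map of $\tilde f$ is a triple $\tilde h=(G,F,h)\in\mathcal C_0$, where $G=(E\sqcap_kE)\sqcap_k\mathbb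 R$ (the product formed in the class $\mathcal C_0$), such that $\mathrm{dom}\,h=\{(x,u,t):x\in\mathrm{dom}\,f,\ u\in E,\ t\in\mathbb R,\ x+tu\in\mathrm{dom}\,f\}$ and $f(x+tu)=f(x)+t\,h(x,u,t)$ for all $(x,u,t)\in\mathrm{dom}\,h$. $\tilde f$ is $k$-th order $\mathcal C_0$-BGN-differentiable over $\mathbb R$, i.e. $\tilde f\in\mathcal D^k_{\rm BGN}(\mathcal C_0,\mathbb R)$, if there is a sequence $(\tilde f_i)$ of members of $\mathcal C_0$, indexed by $0\le i\le k$ (all $i\in\{0,1,\ldots\}$ if $k=\infty$), with $\tilde f_0=\tilde f$ and $\tilde f_{i+1}$ a first order BGN-difference quotient map of $\tilde f_i$ for all finite $i<k$. *)

(* Defs.v *)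
From HB Require Import structures.
From mathcomp Require Import all_boot all_order all_algebra.
From mathcomp Require Import all_classical all_reals all_analysis.

Set Implicit Arguments.
Unset Strict Implicit.
Unset Printing Implicit Defensive.

Import Order.TTheory GRing.Theory Num.Theory.
Import numFieldNormedType.Exports.

Local Open Scope classical_set_scope.
Local Open Scope ring_scope.

(* A real topologized vector space is a [preTopologicalLmodType R]: a vector
   space and a topology on the same carrier, with no compatibility required. *)

Section Kelleyfication.
Variable T : topologicalType.

Definition kopen : set_system T :=
  [set U | forall K : set T, cover_compact K ->
     exists2 V : set T, open V & U `&` K = V `&` K].

Lemma kopenT : kopen setT.
Proof. by move=> K _; exists setT => //; exact: openT. Qed.

Lemma kopenI : setI_closed kopen.
Proof.
move=> A B kA kB K cK; have [V oV AV] := kA K cK; have [W oW BW] := kB K cK.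
exists (V `&` W); first exact: openI.
by rewrite setIIl AV BW -setIIl.
Qed.

Lemma kopen_bigU (I : Type) (f : I -> set T) :
  (forall i, kopen (f i)) -> kopen (\bigcup_i f i).
Proof.
move=> kf K cK.
have /choice[V VP] : forall i, exists V, open V /\ f i `&` K = V `&` K.
  by move=> i; have [V oV fV] := kf i K cK; exists V.
exists (\bigcup_i V i); first by apply: bigcup_open => i _; exact: (VP i).1.
by rewrite !setI_bigcupl; apply: eq_bigcupr => i _; exact: (VP i).2.
Qed.

End Kelleyfication.

Definition compactly_generated (T : topologicalType) : Prop :=
  hausdorff_space T /\ @kopen T = open.

(* The product vector space with the Kelleyfication of the product topology;
   a type alias, since [E * F] itself carries the product topology. *)
Definition kprod (R : realType) (E F : preTopologicalLmodType R) : Type :=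
  (E * F)%type.

HB.instance Definition _ (R : realType) (E F : preTopologicalLmodType R) :=
  GRing.Lmodule.copy (kprod E F) (E * F)%type.

HB.instance Definition _ (R : realType) (E F : preTopologicalLmodType R) :=
  isOpenTopological.Build (kprod E F)
    (@kopenT (E * F)%type) (@kopenI (E * F)%type) (@kopen_bigU (E * F)%type).

Section Spaces.
Variable R : realType.

Definition cgVS (E : preTopologicalLmodType R) : Prop :=
  [/\ compactly_generated E,
      continuous (fun z : kprod E E => (z.1 + z.2 : E)) &
      continuous (fun z : R^o * E => (z.1 *: z.2 : E))].

(* [L] with a second topology: the library's record of a family of open sets. *)
Definition topologize (L : lmodType R) (tau : isOpenTopological L) :
  preTopologicalLmodType R := HB.pack L tau.

Definition is_lcs (E : preTopologicalLmodType R) : Prop :=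
  [/\ continuous (fun z : E * E => (z.1 + z.2 : E)),
      continuous (fun z : R^o * E => (z.1 *: z.2 : E)) &
      exists2 B : set_system E, (forall b, b \in B -> convex_set b) & basis B].

(* Cauchy with respect to the translation-invariant uniformity, written out:
   the uniformity of a [tvsType] is only required to induce its topology. *)
Definition seq_complete (E : preTopologicalLmodType R) : Prop :=
  forall u : nat -> E,
    (forall V : set E, nbhs 0 V -> \forall m & n \near \oo, V (u m - u n)) ->
    exists l : E, u @ \oo --> l.

Definition scgVS (E : preTopologicalLmodType R) : Prop :=
  cgVS E /\
  exists tau : isOpenTopological E,
    let U := topologize tau in
    [/\ is_lcs U, hausdorff_space U, seq_complete U & @open E = @kopen U].

End Spaces.

Section Maps.
Variable R : realType.

Definition pdom (A B : Type) (f : A -> option B) : set A :=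
  [set x | isSome (f x)].

Record partial_map : Type := PartialMap {
  src : preTopologicalLmodType R ;
  tgt : preTopologicalLmodType R ;
  pfun : src -> option tgt }.

Definition C0 (ft : partial_map) : Prop :=
  [/\ scgVS (src ft), scgVS (tgt ft) &
      forall V : set (tgt ft), open V -> open (@pfun ft @^-1` (Some @` V))].

Variant smoothness := Fin of nat | Infty.

Definition le_smoothness (i : nat) (k : smoothness) : bool :=
  if k is Fin n then (i <= n)%N else true.

Definition lt_smoothness (i : nat) (k : smoothness) : bool :=
  if k is Fin n then (i < n)%N else true.

Section Variation.
Variables E F : preTopologicalLmodType R.
Implicit Types f : E -> option F.

(* [t] ranges over the nonzero reals at which the quotient makes sense, so that
   the default value in [odflt] is never used when [pdom f x]. *)
Definition is_variation f (x u : E) (l : F) : Prop :=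
  (fun t : R => t^-1 *: (odflt 0 (f (x + t *: u)) - odflt 0 (f x)) : F)
    @ within [set t | pdom f (x + t *: u)] (0 : R)^' --> l.

Definition variation f (z : kprod E E) : option F :=
  if `[< pdom f z.1 /\ exists l, is_variation f z.1 z.2 l >]
  then Some (xget 0 (is_variation f z.1 z.2)) else None.

End Variation.

Definition seip_variation (ft : partial_map) : partial_map :=
  PartialMap (variation (@pfun ft)).

Definition seip_differentiable (ft : partial_map) : Prop :=
  [/\ C0 ft, C0 (seip_variation ft) &
      forall x u : src ft, pdom (@pfun ft) x -> pdom (variation (@pfun ft)) (x, u)].

Definition D_Seip (k : smoothness) (ft : partial_map) : Prop :=
  exists s : nat -> partial_map,
    [/\ s 0%N = ft,
        forall i, le_smoothness i k -> C0 (s i) &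
        forall i, lt_smoothness i k ->
          seip_differentiable (s i) /\ s i.+1 = seip_variation (s i)].

(* For classes [C] of maps between Seip-convenient spaces, whose products are
   the [kprod]s. *)
Section BGN.
Variable C : partial_map -> Prop.

Definition BGN_quotient (ft ht : partial_map) : Prop :=
  let E := src ft in let F := tgt ft in let f := @pfun ft in
  exists h : kprod (kprod E E) R^o -> option F,
    [/\ ht = PartialMap h,
        C ht,
        forall (x u : E) (t : R),
          pdom h (x, u, t) <-> pdom f x /\ pdom f (x + t *: u) &
        forall (x u : E) (t : R) (y v : F),
          f x = Some y -> h (x, u, t) = Some v ->
          f (x + t *: u) = Some (y + t *: v)].

Definition D_BGN (k : smoothness) (ft : partial_map) : Prop :=
  exists s : nat -> partial_map,
    [/\ s 0%N = ft,
        forall i, le_smoothness i k -> C (s i) &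
        forall i, lt_smoothness i k -> BGN_quotient (s i) (s i.+1)].

End BGN.

End Maps.

(* Main.v *)
Require Import Defs.
From HB Require Import structures.
From mathcomp Require Import all_boot all_order all_algebra.
From mathcomp Require Import all_classical all_reals all_analysis.
From mathcomp Require Import ring lra.
Set Implicit Arguments.
Unset Strict Implicit.
Unset Printing Implicit Defensive.
Import Order.TTheory GRing.Theory Num.Theory.
Import numFieldNormedType.Exports.
Local Open Scope classical_set_scope.
Local Open Scope ring_scope.

(** The two hierarchies agree order by order.  A difference quotient [h] of [f]
    restricts at [t = 0] to the variation of [f] ([dquotient_variation]), so the
    variation of a BGN map of order [k + 1] is a BGN map of order [k] composed
    with a continuous linear map, and BGN maps are Seip maps by induction
    ([bgn_seip]).  Difference quotients and variations are both unique, hence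
    the infinite order is the intersection of the finite ones ([D_SeipP],
    [D_BGNP]).

    For the converse ([seip_bgn]) let [f] be a Seip map of order [k + 1].  Its
    difference quotient is [t^-1 *: (f (x + t *: u) - f x)] for [t <> 0], and
    near [t = 0] it is the integral of the variation of [f] at
    [(x + (s * t) *: u, u)] over [s] in [0, 1].  By induction [f] and its
    variation are BGN maps of order [k], and one shows that both expressions
    are as well.  This needs a calculus in which one never differentiates: all
    the rules are algebraic identities between difference quotients.  They are
    the chain rule [bgn_comp], the rules for pairs, scalar multiplication and
    inversion, stability under parameter integrals [bgn_pintegral] (the
    quotient of an integral is the integral of the quotient), and locality
    [bgn_local], which glues the two expressions.

    The analytic input is the integral [scgVS_integral].  It is the limit of
    Riemann sums in the locally convex topology behind a Seip-convenient space,
    and exists by sequential completeness.  The fundamental theorem of calculus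
    comes from the mean value inequality [mean_value_convex].  Its continuous
    dependence on parameters is a tube lemma for Kelleyfied products
    [kopen_tube], followed by the passage from the locally convex topology to
    its Kelleyfication [pcontinuous_kopen].

    Finally the spaces on which quotients and variations live must be
    Seip-convenient again ([scgVS_kprod], [scgVS_R]); here the local compactness
    of the real line enters through [kopen_prodR]. *)

(** * Continuous partial maps with open domain *)

Lemma pdom_some (A B : Type) (f : A -> option B) x :
  pdom f x -> exists y, f x = Some y.
Proof. by rewrite /pdom/=; case: (f x) => // y _; exists y. Qed.

Section PartialContinuity.
Implicit Types S T U : topologicalType.

(** Continuity together with openness of the domain: the case [V = setT] says
    that the domain is open. *)
Definition pcontinuous S T (f : S -> option T) : Prop :=
  forall V : set T, open V -> open (f @^-1` (Some @` V)).

Definition opair (A B C : Type) (f : A -> option B) (g : A -> option C) x :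
    option (B * C) :=
  if f x is Some y then if g x is Some z then Some (y, z) else None else None.

Lemma pcontinuousP S T (f : S -> option T) :
  pcontinuous f <-> forall x y (A : set T), f x = Some y -> nbhs y A ->
    \forall x' \near x, exists2 y', A y' & f x' = Some y'.
Proof.
split=> [cf x y A fx|H V oV].
  rewrite nbhsE => -[B [oB By] BA].
  have : nbhs x (f @^-1` (Some @` B)).
    by apply: open_nbhs_nbhs; split; [exact: cf|exists y].
  by apply: filterS => x' [y' By' fx']; exists y' => //; exact: BA.
rewrite openE => x [y Vy fx].
have := H x y V (esym fx) (open_nbhs_nbhs (conj oV Vy)).
by apply: filterS => x' [y' Vy' fx']; exists y'.
Qed.

Lemma pcontinuous_dom S T (f : S -> option T) : pcontinuous f -> open (pdom f).
Proof.
move=> cf; rewrite (_ : pdom f = f @^-1` (Some @` setT)); first exact/cf/openT.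
apply/seteqP; split=> z; rewrite /pdom/=; last by move=> [? _ <-].
by case: (f z) => // w _; exists w.
Qed.

Lemma pcontinuous_at S T (f : S -> option T) x y t0 : pcontinuous f ->
  f x = Some y -> {for x, continuous (fun x => odflt t0 (f x))}.
Proof.
move=> /pcontinuousP cf fx A; rewrite fx /= => /(cf _ _ _ fx).
by apply: filterS => x' [y' Ay' fx']; rewrite /= fx'.
Qed.

(** Preimages under a composition of partial maps are iterated preimages, also
    where the domains are concerned. *)
Lemma pcontinuous_comp S T U (f : S -> option T) (g : T -> option U) :
  pcontinuous f -> pcontinuous g -> pcontinuous (fun x => obind g (f x)).
Proof.
move=> cf cg V oV; have := cf _ (cg V oV).
congr open; apply/seteqP; split=> x /=.
  by move=> [y [z Vz gy] <-]; exists z.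
by move=> [z Vz]; case: (f x) => //= y gy; exists y => //; exists z.
Qed.

Lemma pcontinuous_total S T (f : S -> T) :
  continuous f -> pcontinuous (fun x => Some (f x)).
Proof.
move=> /continuousP cf V oV; have := cf V oV.
congr open; apply/seteqP; split=> x /=; first by move=> Vx; exists (f x).
by move=> [y Vy [<-]].
Qed.

Lemma pcontinuous_precomp S T U (f : S -> T) (g : T -> option U) :
  continuous f -> pcontinuous g -> pcontinuous (fun x => g (f x)).
Proof. by move=> /pcontinuous_total cf cg; exact: pcontinuous_comp cf cg. Qed.

Lemma pcontinuous_pair S T U (f : S -> option T) (g : S -> option U) :
  pcontinuous f -> pcontinuous g -> @pcontinuous S (T * U)%type (opair f g).
Proof.
move=> /pcontinuousP cf /pcontinuousP cg; apply/pcontinuousP => x [y z] A.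
rewrite /opair; case fx: (f x) => [y'|//]; case gx: (g x) => [z'|//] [<- <-].
move=> [[B C] [/= nB nC] BCA]; apply: filterS2 (cf _ _ _ fx nB) (cg _ _ _ gx nC).
by move=> x' [u Bu ->] [v Cv ->]; exists (u, v) => //; exact: BCA.
Qed.

End PartialContinuity.

(** * Kelleyfication and compact sets *)

Section Topology.
Implicit Types S T : topologicalType.

(** The equality of both notions on pointed spaces extends to all spaces since
    only the empty set has to be treated apart. *)
Lemma compactE T : @compact T = @cover_compact T.
Proof.
apply/seteqP; split => A.
  have [->|/set0P[x _] cA] := eqVneq A set0.
    by move=> _ I D f _ _; exists finmap.fset0.
  pose P : ptopologicalType := HB.pack_for ptopologicalType (T : Type)
    (isPointed.Build T x) (Topological.on T).
  have : @compact P A by [].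
  by rewrite (@compact_cover P).
have [->|/set0P[x _] cA] := eqVneq A set0; first by move=> _; exact: compact0.
pose P : ptopologicalType := HB.pack_for ptopologicalType (T : Type)
  (isPointed.Build T x) (Topological.on T).
suff : @compact P A by [].
by rewrite (@compact_cover P).
Qed.

Lemma open_kopen T (U : set T) : open U -> kopen U.
Proof. by move=> oU K _; exists U. Qed.

(** The local form lets a neighbourhood be chosen for each point separately. *)
Lemma kopen_locally T (U : set T) :
  kopen U <-> forall (K : set T) x, compact K -> K x -> U x ->
    exists2 G : set T, open_nbhs x G & G `&` K `<=` U.
Proof.
split=> [kU K x|hU K].
  rewrite compactE => /kU[V oV UV] Kx Ux; exists V; last first.
    by move=> y; rewrite -UV => -[].
  by split=> //; have : (U `&` K) x by []; rewrite UV => -[].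
rewrite -compactE => cK.
exists (\bigcup_(G in [set G | open G /\ G `&` K `<=` U]) G).
  by apply: bigcup_open => G [].
apply/seteqP; split=> x; last by move=> [[G [_ GU] Gx] Kx]; split=> //; exact: GU.
by move=> [Ux Kx]; have [G [oG Gx] GU] := hU K x cK Kx Ux; split=> //; exists G.
Qed.

Lemma pcontinuous_compact S T (f : S -> option T) (C : set S) :
  pcontinuous f -> compact C -> C `<=` pdom f ->
  compact [set y | exists2 x, C x & f x = Some y].
Proof.
rewrite !compactE => cf cC Cf I D g og fCg.
have [i Di|x Cx|D' DD' CD'] :=
    cC I D (fun i => f @^-1` (Some @` g i)).
- exact/cf/og.
- have [y fx] := pdom_some (Cf x Cx).
  have [|i Di giy] := fCg y; first by exists x.
  by exists i => //; exists y.
- exists D' => // y [x Cx fx].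
  have [i D'i [z gz]] := CD' x Cx; rewrite fx => -[zy].
  by exists i => //; rewrite -zy.
Qed.

(** The points of [K] outside [D] form a compact set which misses [x], so that
    finitely many of the separating pairs of open sets already separate all of
    it from [x]; the near-covering form of compactness does this selection. *)
Lemma hausdorff_compact_separated T (K D : set T) x :
  hausdorff_space T -> compact K -> open D -> D x ->
  exists2 G, open_nbhs x G & closure G `&` K `<=` D.
Proof.
move=> hT cK oD Dx.
have /compact_near_coveringP cKD : compact (K `&` ~` D).
  by apply: compact_closedI => //; exact: open_closedC.
have [] := cKD _ (powerset_filter_from (nbhs x)) (fun W z => ~ closure W z).
  move=> z [_ /= nDz].
  have xz : x != z by apply: contra_notN nDz => /eqP <-.
  move: (hT); rewrite open_hausdorff => /(_ x z xz)[[A B]]/=.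
  rewrite !inE => -[Ax Bz] [oA oB AB].
  exists (B, [set W | nbhs x W /\ W `<=` A]).
    split=> /=; first exact: open_nbhs_nbhs.
    by apply: powerset_filter_fromP; exact: open_nbhs_nbhs.
  move=> [z' W]/= [Bz' [_ WA]] /(_ B) []; first exact: open_nbhs_nbhs.
  move=> w [Ww Bw]; have : (A `&` B) w by split=> //; exact: WA.
  by rewrite AB.
move=> M [MF ME2 [W MW]] /(_ W MW) WKD.
exists W°; first by split; [exact: open_interior|exact: MF].
move=> y [cWy Ky]; apply: contrapT => nDy; apply: (WKD y); first by split.
by apply: closureS cWy; exact: interior_subset.
Qed.

(** On a compact set [C] the map [f] takes values in the compact set [f(C)], on
    which the topology of the target and its Kelleyfication agree.  The domain
    of [f] may meet a compact set [K] in a non-compact set, hence the passage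
    to a compact neighbourhood in [K] of the point under consideration. *)
Lemma pcontinuous_kopen S T (f : S -> option T) :
  compactly_generated S -> pcontinuous f ->
  forall V : set T, kopen V -> open (f @^-1` (Some @` V)).
Proof.
move=> [hS kS] cf V kV; rewrite -kS; apply/kopen_locally => K x cK Kx [y Vy fx].
have oD := pcontinuous_dom cf.
have Dx : pdom f x by rewrite /pdom /= -fx.
have [G Gx GD] := hausdorff_compact_separated hS cK oD Dx.
have cC : compact (closure G `&` K).
  rewrite setIC; apply: compact_closedI => //; exact: closed_closure.
have := pcontinuous_compact cf cC GD; set fC := (X in compact X).
rewrite compactE => /kV[W oW VW].
exists (G `&` f @^-1` (Some @` W)).
  split; first by apply: openI; [case: Gx|exact: cf].
  split; first by case: Gx.
  exists y => //; suff : (W `&` fC) y by case.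
  rewrite -VW; split=> //; exists x => //; split=> //; apply: subset_closure.
  by case: Gx.
move=> z [[Gz [w Ww fz]] Kz]; exists w => //.
suff : (V `&` fC) w by case.
rewrite VW; split=> //; exists z => //; split=> //; exact: subset_closure.
Qed.

Lemma kopen_continuous S T (f : S -> T) (V : set T) :
  continuous f -> kopen V -> kopen (f @^-1` V).
Proof.
move=> /continuousP cf kV K; rewrite -compactE => cK.
have /kV[W oW VW] : cover_compact (f @` K).
  rewrite -compactE; apply: continuous_compact => //.
  by apply: continuous_subspaceT; apply/continuousP.
exists (f @^-1` W); first exact: cf.
apply/seteqP; split=> x [fx Kx]; split=> //.
  by have [] : (W `&` f @` K) (f x) by rewrite -VW; split=> //; exists x.
by have [] : (V `&` f @` K) (f x) by rewrite VW; split=> //; exists x.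
Qed.

(** A topology and its Kelleyfication have the same compact sets, because they
    induce the same topology on each of them. *)
Lemma kopen_finite_cover T (K : set T) (I : choiceType) (D : set I)
    (f : I -> set T) :
  compact K -> (forall i, D i -> kopen (f i)) -> K `<=` cover D f ->
  finite_subset_cover D f K.
Proof.
rewrite compactE => cK kf Kf.
have /choice[g gP] : forall i, exists V, D i -> open V /\ f i `&` K = V `&` K.
  move=> i; have [Di|nDi] := pselect (D i); last by exists setT.
  by have [V oV fV] := kf i Di K cK; exists V.
have [i /gP[]//|x Kx|D' DD' KD'] := cK I D g.
  have [i Di fi] := Kf x Kx; exists i => //.
  have [_ fg] := gP i Di.
  by have [] : (g i `&` K) x by rewrite -fg.
exists D' => // x Kx; have [i D'i gi] := KD' x Kx; exists i => //.
have [_ fg] := gP i (set_mem (DD' i D'i)).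
by have [] : (f i `&` K) x by rewrite fg.
Qed.

Lemma open_tube S T (N : set T) (W : set (S * T)) :
  compact N -> open W -> open [set a | forall s, N s -> W (a, s)].
Proof.
move=> /compact_near_coveringP cN oW; rewrite openE => a /= Wa.
have := cN _ (nbhs a) (fun a' s => W (a', s)) _; apply.
move=> s Ns; have : nbhs (a, s) W by apply: open_nbhs_nbhs; split=> //; exact: Wa.
move=> [[A B] [/= Aa Bs] AB]; exists (B, A) => //.
by move=> [s' a']/= [Bs' Aa']; exact: AB.
Qed.

(** Only products [K * N] have to be tested, and on these [W] is open. *)
Lemma kopen_tube S T (N : set T) (W : set (S * T)) :
  compact N -> kopen W -> kopen [set a | forall s, N s -> W (a, s)].
Proof.
move=> cN kW K; rewrite -compactE => cK.
have := compact_setX cK cN; rewrite compactE => /kW[V oV WV].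
exists [set a | forall s, N s -> V (a, s)]; first exact: open_tube.
apply/seteqP; split=> a [/= Ha Ka]; split=> // s Ns.
  suff : (V `&` K `*` N) (a, s) by case.
  by rewrite -WV; split=> //; exact: Ha.
suff : (W `&` K `*` N) (a, s) by case.
by rewrite WV; split=> //; exact: Ha.
Qed.

Lemma compact_generated_continuous S T (f : S -> T) (V : set T) :
  compactly_generated S -> continuous f -> kopen V -> open (f @^-1` V).
Proof. by move=> [_ <-]; exact: kopen_continuous. Qed.

Lemma continuous_pair S T (U : topologicalType) (f : S -> T) (g : S -> U) :
  continuous f -> continuous g -> continuous (fun x => (f x, g x)).
Proof. by move=> cf cg x; apply: cvg_pair; [exact: cf|exact: cg]. Qed.

Lemma continuous_compose S T (U : topologicalType) (f : S -> T) (g : T -> U) :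
  continuous f -> continuous g -> continuous (fun x => g (f x)).
Proof. by move=> cf cg x; apply: cvg_comp; [exact: cf|exact: cg]. Qed.

End Topology.

Section RealLine.
Variable R : realType.

Lemma compactly_generated_R : compactly_generated R^o.
Proof.
split; first exact: (@norm_hausdorff R R^o).
apply/seteqP; split; last by move=> U; exact: open_kopen.
move=> U /kopen_locally kU; rewrite openE => x Ux.
have Kx : `[x - 1, x + 1]%classic x.
  by rewrite /= in_itv/=; apply/andP; split; lra.
have [G Gx GU] := kU _ x (@segment_compact R (x - 1) (x + 1)) Kx Ux.
have nG : nbhs (x : R^o) G by exact: open_nbhs_nbhs.
apply: (filterS GU); apply: filterI => //.
apply: filterS (nbhsx_ballx x 1 ltr01) => y; rewrite -ball_normE/=.
by rewrite ltr_norml in_itv/= => /andP[? ?]; apply/andP; split; lra.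
Qed.

(** The real line is locally compact: around a point of [W] choose a compact
    interval [N] in the corresponding slice, and apply the tube lemma to it.
    This is what makes scalar multiplication on a product continuous for the
    ordinary product topology. *)
Lemma kopen_prodR (S : topologicalType) (W : set (S * R^o)) :
  compactly_generated S -> kopen W -> open W.
Proof.
move=> [_ kS] kW; rewrite openE => -[a r] War.
have : open [set s | W (a, s)].
  rewrite -(compactly_generated_R.2).
  apply: (kopen_continuous (f := fun s : R^o => (a, s))) => //.
  by apply: continuous_pair => [s|s]; [exact: cvg_cst|exact: cvg_id].
rewrite openE => /(_ r War); rewrite /interior -nbhs_ballE => -[e /= e0 eW].
pose N := `[r - e / 2, r + e / 2]%classic.
have cN : @compact R^o N by exact: segment_compact.
have := kopen_tube cN kW; rewrite kS => oA.
exists ([set a' | forall s, N s -> W (a', s)], N); last first.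
  by move=> [a' s']/= [Wa' Ns']; exact: Wa'.
split=> /=.
  apply: open_nbhs_nbhs; split=> //= s Ns; apply: eW.
  move: Ns; rewrite /N /= in_itv/= -ball_normE/= ltr_norml => /andP[? ?].
  by apply/andP; split; lra.
have e20 : 0 < e / 2 by lra.
apply: filterS (nbhsx_ballx (r : R^o) (e / 2) e20) => y; rewrite -ball_normE/=.
by rewrite ltr_norml /N /= in_itv/= => /andP[? ?]; apply/andP; split; lra.
Qed.

End RealLine.

(** * Products of Seip-convenient spaces *)

Section Kprod.
Variable R : realType.
Implicit Types E F : preTopologicalLmodType R.

Lemma hausdorff_prod (S T : topologicalType) :
  hausdorff_space S -> hausdorff_space T -> hausdorff_space (S * T)%type.
Proof.
move=> hS hT [x y] [x' y'] cl; congr (_, _).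
  apply: hS => A B xA xB.
  have [z [/= zA zB]] := cl (fst @^-1` A) (fst @^-1` B) (cvg_fst xA) (cvg_fst xB).
  by exists z.1.
apply: hT => A B xA xB.
have [z [/= zA zB]] := cl (snd @^-1` A) (snd @^-1` B) (cvg_snd xA) (cvg_snd xB).
by exists z.2.
Qed.

Lemma compact_kprod E F (K : set (E * F)) :
  @compact (kprod E F) K = @compact (E * F)%type K.
Proof.
apply/propext; split=> cK.
  rewrite compactE => I D f fo; move: cK; rewrite compactE; apply=> i Di.
  exact/open_kopen/fo.
rewrite compactE => I D f fo.
exact: (@kopen_finite_cover (E * F)%type K I D f cK fo).
Qed.

Lemma compactly_generated_kprod E F :
  hausdorff_space E -> hausdorff_space F -> compactly_generated (kprod E F).
Proof.
move=> hE hF; split.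
  move=> p q cl; apply: (@hausdorff_prod E F hE hF) => A B.
  rewrite !nbhsE => -[A' [oA Ap] A'A] [B' [oB Bq] B'B].
  have [||z [Az Bz]] := cl A' B'.
  - by apply: open_nbhs_nbhs; split=> //; exact: open_kopen.
  - by apply: open_nbhs_nbhs; split=> //; exact: open_kopen.
  - by exists z; split; [exact: A'A|exact: B'B].
apply/seteqP; split; last by move=> U; exact: open_kopen.
move=> U kU; suff : @kopen (E * F)%type U by [].
move=> K; rewrite -compactE => cK.
have : @compact (kprod E F) K by rewrite compact_kprod.
rewrite compactE => /kU[V oV UV].
have := cK; rewrite compactE => /oV[W oW VW].
by exists W => //; rewrite UV.
Qed.

Lemma fst_continuous_kprod E F : continuous (fun z : kprod E F => z.1).
Proof.
apply/continuousP => A oA; apply: (@open_kopen (E * F)%type).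
by apply: (continuousP _).1 oA; move=> z; exact: cvg_fst.
Qed.

Lemma snd_continuous_kprod E F : continuous (fun z : kprod E F => z.2).
Proof.
apply/continuousP => A oA; apply: (@open_kopen (E * F)%type).
by apply: (continuousP _).1 oA; move=> z; exact: cvg_snd.
Qed.

Lemma continuous_kpair (S : topologicalType) E F (f : S -> E) (g : S -> F) :
  compactly_generated S -> continuous f -> continuous g ->
  continuous (fun x => (f x, g x) : kprod E F).
Proof.
move=> cS cf cg; apply/continuousP => A oA.
apply: (@compact_generated_continuous S (E * F)%type) => //.
exact: continuous_pair.
Qed.

Lemma cgVS_kprod E F : cgVS E -> cgVS F -> cgVS (kprod E F).
Proof.
move=> [[hE kE] aE sE] [[hF kF] aF sF].
have cEF := compactly_generated_kprod hE hF.
have cEF2 := compactly_generated_kprod cEF.1 cEF.1.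
split=> //.
  suff : continuous (fun z : kprod (kprod E F) (kprod E F) =>
    (z.1.1 + z.2.1, z.1.2 + z.2.2) : kprod E F) by [].
  have c11 := continuous_compose (@fst_continuous_kprod (kprod E F) (kprod E F))
    (@fst_continuous_kprod E F).
  have c12 := continuous_compose (@fst_continuous_kprod (kprod E F) (kprod E F))
    (@snd_continuous_kprod E F).
  have c21 := continuous_compose (@snd_continuous_kprod (kprod E F) (kprod E F))
    (@fst_continuous_kprod E F).
  have c22 := continuous_compose (@snd_continuous_kprod (kprod E F) (kprod E F))
    (@snd_continuous_kprod E F).
  apply: continuous_kpair => //.
    exact: (continuous_compose (continuous_kpair cEF2 c11 c21) aE).
  exact: (continuous_compose (continuous_kpair cEF2 c12 c22) aF).
have sw : continuous (fun z : kprod E F * R^o =>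
    (z.2 *: z.1.1, z.2 *: z.1.2) : E * F).
  have c1 : continuous (fun z : kprod E F * R^o => z.1) by move=> z; exact: cvg_fst.
  have c2 : continuous (fun z : kprod E F * R^o => z.2) by move=> z; exact: cvg_snd.
  apply: continuous_pair.
    exact: (continuous_compose (continuous_pair c2
      (continuous_compose c1 (@fst_continuous_kprod E F))) sE).
  exact: (continuous_compose (continuous_pair c2
      (continuous_compose c1 (@snd_continuous_kprod E F))) sF).
apply/continuousP => A oA.
have /(kopen_prodR cEF) := kopen_continuous sw oA.
have /continuousP := @swap_continuous R^o (kprod E F).
by move=> /[apply].
Qed.

End Kprod.

(** An alias of the carrier on which the axioms of a locally convex space are
    recorded as structure, so that it becomes a [tvsType] with the topology it
    already had. *)
Definition lcs_tvs (R : realType) (E : preTopologicalLmodType R)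
  (lE : is_lcs E) : Type := E.

Section LcsTvs.
Variables (R : realType) (E : preTopologicalLmodType R) (lE : is_lcs E).

HB.instance Definition _ := PreTopologicalLmodule.copy (lcs_tvs lE) E.
HB.instance Definition _ :=
  PreTopologicalLmod_isTvs.Build R (lcs_tvs lE) (let: And3 a s c := lE in a)
    (let: And3 a s c := lE in s) (let: And3 a s c := lE in c).
HB.instance Definition _ :=
  PreTopologicalNmodule_isTopologicalNmodule.Build (lcs_tvs lE)
    (let: And3 a s c := lE in a).
HB.instance Definition _ :=
  TopologicalNmodule_isTopologicalLmodule.Build R (lcs_tvs lE)
    (let: And3 a s c := lE in s).
HB.instance Definition _ :=
  Uniform_isTvs.Build R (lcs_tvs lE) (let: And3 a s c := lE in c).

End LcsTvs.

Section Recorded.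
Variables (R : realType) (P : preTopologicalLmodType R).

(** The topology of [P] as a bare family of open sets, to be put back on the
    underlying vector space by [topologize].  The neighbourhood filters of the
    result are equal but not convertible to those of [P], so that properties
    have to be transported. *)
Definition recorded_topology : isOpenTopological P :=
  isOpenTopological.Build P openT openI
    (fun I f (fo : forall i : I, open (f i)) => bigcup_open (fun i _ => fo i)).

Let U := topologize recorded_topology.

Lemma nbhs_recorded (x : P) : @nbhs U U x = nbhs x.
Proof. by rewrite !nbhsE. Qed.

Lemma is_lcs_recorded : is_lcs P -> is_lcs U.
Proof.
move=> [aP sP [B cB [oB bB]]]; split.
- move=> z A; rewrite /= nbhs_recorded => /aP[[C D] [/= nC nD] CD].
  by exists (C, D) => //; split; rewrite /= nbhs_recorded.
- move=> z A; rewrite /= nbhs_recorded => /sP[[C D] [/= nC nD] CD].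
  by exists (C, D) => //; split; rewrite /= ?nbhs_recorded.
- exists B => //; split=> // x A; rewrite /= nbhs_recorded => nA.
  exact: bB nA.
Qed.

Lemma hausdorff_recorded : hausdorff_space P -> hausdorff_space U.
Proof.
by move=> hP x y cl; apply: hP => A B nA nB; apply: cl; rewrite nbhs_recorded.
Qed.

Lemma seq_complete_recorded : seq_complete P -> seq_complete U.
Proof.
move=> sP u Hu; have [|l ul] := sP u.
  by move=> V nV; apply: Hu; rewrite nbhs_recorded.
by exists l => A; rewrite nbhs_recorded => nA; exact: ul.
Qed.

End Recorded.

Section ScgVS.
Variable R : realType.
Implicit Types E F : preTopologicalLmodType R.

(** The locally convex topology is the product of the given ones [UE] and [UF].
    Its Kelleyfication is that of the product of the compactly generated
    topologies: a compact set [K] lies in the product of its two projections,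
    and on compact sets [UE] and [UF] induce the same topologies as their
    Kelleyfications do. *)
Lemma scgVS_kprod E F : scgVS E -> scgVS F -> scgVS (kprod E F).
Proof.
move=> [cE [tE]] /= + [cF [tF]] /=.
set UE := topologize tE; set UF := topologize tF.
move=> [lE hE qE kE] [lF hF qF kF]; split; first exact: cgVS_kprod.
pose T : tvsType R := (lcs_tvs lE * lcs_tvs lF)%type.
pose P : preTopologicalLmodType R := T.
exists (recorded_topology P).
have lP : is_lcs P.
  split.
  - exact: (@add_continuous T).
  - exact: (@scale_continuous R T).
  - exact: (@locally_convex R T).
split.
- exact: (is_lcs_recorded lP).
- exact: (@hausdorff_recorded R P (hausdorff_prod hE hF)).
- apply: (@seq_complete_recorded R P) => u Hu.
  have [|l ul] := qE (fst \o u).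
    move=> V nV; have : nbhs (0 : P) (V `*` setT).
      by exists (V, setT) => //; split=> //; exact: filterT.
    by move=> /Hu; apply: filterS => -[m n]/= [].
  have [|l' ul'] := qF (snd \o u).
    move=> V nV; have : nbhs (0 : P) (setT `*` V).
      by exists (setT, V) => //; split=> //; exact: filterT.
    by move=> /Hu; apply: filterS => -[m n]/= [].
  exists (l, l') => A [[B C] [/= nB nC] BCA].
  have uB : \forall n \near \oo, B (u n).1 by exact: ul.
  have uC : \forall n \near \oo, C (u n).2 by exact: ul'.
  by apply: filterS2 uB uC => n ? ?; exact: BCA.
(* [UP] and [PU] compare the product of the coarse topologies with that of their
   Kelleyfications; they give the same compact sets by [cP]. *)
have UP (V : set (E * F)) : @open P V -> @open (E * F)%type V.
  rewrite !openE => oV z /oV[[A B] [/= nA nB] ABV]; exists (A, B) => //.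
  split=> /=.
    move: nA; rewrite !nbhsE => -[A' [oA' A'z] A'A]; exists A' => //.
    by split=> //; rewrite kE; exact: open_kopen.
  move: nB; rewrite !nbhsE => -[B' [oB' B'z] B'B]; exists B' => //.
  by split=> //; rewrite kF; exact: open_kopen.
have PU (V : set (E * F)) : @open (E * F)%type V -> @kopen P V.
  rewrite openE => oV; apply/kopen_locally => K x cK Kx /oV[[A B] [/= nA nB] ABV].
  have cK1 : @compact UE (fst @` K).
    apply: (@continuous_compact P UE fst K) cK.
    by apply: continuous_subspaceT => z; exact: cvg_fst.
  have cK2 : @compact UF (snd @` K).
    apply: (@continuous_compact P UF snd K) cK.
    by apply: continuous_subspaceT => z; exact: cvg_snd.
  move: nA nB; rewrite !nbhsE => -[A' [oA' A'x] A'A] [B' [oB' B'x] B'B].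
  move: oA' oB'; rewrite kE kF => /kopen_locally oA' /kopen_locally oB'.
  have [||A2 A2x A2A] := oA' _ x.1 cK1; [by exists x|by []|].
  have [||B2 B2x B2B] := oB' _ x.2 cK2; [by exists x|by []|].
  exists (A2 `*` B2); last first.
    move=> z [[/= zA zB] Kz]; apply: ABV; split=> /=.
      by apply/A'A/A2A; split=> //; exists z.
    by apply/B'B/B2B; split=> //; exists z.
  rewrite open_nbhsE; split.
    rewrite openE => z [/= zA zB]; exists (A2, B2) => //; split=> /=.
      by apply: (@open_nbhs_nbhs UE); split=> //; exact: A2x.1.
    by apply: (@open_nbhs_nbhs UF); split=> //; exact: B2x.1.
  by exists (A2, B2) => //; split=> /=;
    [exact: (@open_nbhs_nbhs UE)|exact: (@open_nbhs_nbhs UF)].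
have cP (K : set (E * F)) : @compact P K = @compact (E * F)%type K.
  apply/propext; split=> cK; rewrite compactE => I D f fo Kf.
    by apply: (@kopen_finite_cover P) => // i Di; exact/PU/fo.
  by move: cK; rewrite compactE; apply=> // i Di; exact/UP/fo.
suff : @kopen (E * F)%type = @kopen P by [].
apply/seteqP; split=> V kV K; rewrite -compactE.
  rewrite cP => cK; have := cK; rewrite compactE => /kV[W oW VW].
  have := cK; rewrite -cP compactE => /(PU W oW)[W' oW' WW'].
  by exists W' => //; rewrite VW.
rewrite -cP => cK; have := cK; rewrite compactE => /kV[W oW VW].
by exists W => //; exact: UP.
Qed.

Lemma scgVS_R : scgVS (R^o : preTopologicalLmodType R).
Proof.
split.
  split.
  - exact: compactly_generated_R.
  - apply/continuousP => A oA; apply: open_kopen.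
    exact: ((continuousP _).1 (@add_continuous R^o) A oA).
  - exact: (@scale_continuous R R^o).
exists (recorded_topology R^o); split.
- apply: is_lcs_recorded; split.
  - exact: (@add_continuous R^o).
  - exact: (@scale_continuous R R^o).
  - exact: (@locally_convex R R^o).
- apply: hausdorff_recorded; exact: (compactly_generated_R R).1.
- apply: seq_complete_recorded => u Hu.
  have /cauchy_cvg : cauchy (u @ \oo).
    apply/cauchy_ballP => e e0.
    have nV : nbhs (0 : R^o) [set x : R^o | `|x| < e].
      apply: filterS (nbhsx_ballx (0 : R^o) e e0) => x.
      by rewrite -ball_normE/= sub0r normrN.
    have [[A B] [/= nA nB] AB] := Hu _ nV.
    by exists (u @` A, u @` B);
      [split=> /=; [apply: filterS nA|apply: filterS nB] => n ?; exists n
      |move=> [x y]/= [[m Am <-] [n Bn <-]]; rewrite -ball_normE/=; exact: (AB (m, n))].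
  by move=> cu; exists (lim (u @ \oo)).
- rewrite -[LHS](compactly_generated_R R).2.
  by [].
Qed.

End ScgVS.

(** * Convex neighbourhoods and Riemann sums in a locally convex space *)

Section TvsLimits.
Variables (R : realType) (T : tvsType R).

Lemma cvg_sub (I : Type) (G : set_system I) {FG : Filter G} (u v : I -> T) l m :
  u @ G --> l -> v @ G --> m -> (fun i => u i - v i) @ G --> l - m.
Proof.
move=> ul vm.
apply: (cvg_comp (fun i => (u i, v i)) (fun z : T * T => z.1 - z.2) _
  (@sub_continuous T (l, m))).
exact: cvg_pair.
Qed.

Lemma cvg_scale (I : Type) (G : set_system I) {FG : Filter G} (r : R) (u : I -> T) l :
  u @ G --> l -> (fun i => r *: u i) @ G --> r *: l.
Proof.
move=> ul.
apply: (cvg_comp (fun i => (r, u i)) (fun z : R^o * T => z.1 *: z.2) _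
  (@scale_continuous R T (r, l))).
by apply: (@cvg_pair _ _ _ _ (nbhs (r : R^o))); [exact: cvg_cst|exact: ul].
Qed.

Lemma nbhs0_translate (x : T) (V : set T) :
  nbhs x V -> nbhs (0 : T) [set w | V (x + w)].
Proof.
move=> nV; have := @add_continuous T (x, 0) V.
rewrite /= addr0 => /(_ nV)[[B C] [/= nB nC] BC].
by apply: filterS nC => w Cw; apply: (BC (_, w)); split=> //; exact: nbhs_singleton.
Qed.

Lemma open_scaled_difference (r : R) (V : set T) : open V ->
  open [set z : T * T | V (r *: (z.1 - z.2))].
Proof.
have cs : continuous (fun z : T * T => r *: (z.1 - z.2)).
  by move=> z; apply: cvg_scale; exact: sub_continuous.
by move=> oV; exact: ((continuousP _).1 cs V oV).
Qed.

End TvsLimits.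

Section Convexity.
Variables (R : realType) (T : tvsType R).
Implicit Types V W : set T.

Definition convex_comb_closed V := forall (a b : R) (x y : T), 0 <= a -> 0 <= b ->
  a + b = 1 -> V x -> V y -> V (a *: x + b *: y).

Lemma nbhs0_convex W : nbhs (0 : T) W ->
  exists V, [/\ open V, V 0, V `<=` W & convex_comb_closed V].
Proof.
have [B cB [oB bB]] := @locally_convex R T.
move=> /bB[V [BV V0] VW]; exists V; split=> //; first exact: oB.
move=> a b x y a0 b0 ab Vx Vy.
have a1 : a <= 1 by lra.
have <- : 1 - a = b by lra.
exact/set_mem/(cB V (mem_set BV) x y (Itv01 a0 a1) (mem_set Vx) (mem_set Vy)).
Qed.

(** The average of [n + 1] points is a convex combination of the average of the
    first [n] with the last one. *)
Lemma convex_average V (v : nat -> T) n : convex_comb_closed V -> (0 < n)%N ->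
  (forall i, (i < n)%N -> V (v i)) -> V (n%:R^-1 *: \sum_(0 <= i < n) v i).
Proof.
move=> cV; elim: n => // n IH _ Vv; rewrite big_nat_recr//=.
have [->|n0] := posnP n.
  by rewrite big_nil add0r invr1 scale1r; apply: Vv.
have n0' : (n%:R : R) != 0 by rewrite pnatr_eq0 -lt0n.
have n1' : (n.+1%:R : R) != 0 by rewrite pnatr_eq0.
set S := \sum_(_ <= _ < _) _.
have -> : n.+1%:R^-1 *: (S + v n) =
    (n.+1%:R^-1 * n%:R) *: (n%:R^-1 *: S) + n.+1%:R^-1 *: v n :> T.
  by rewrite scalerA mulfK// scalerDr.
apply: cV => //.
- by rewrite -[X in _ + X]mulr1 -mulrDr natr1 mulVf.
- by apply: IH => // i ilt; apply: Vv; exact: ltnW.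
- exact: Vv.
Qed.

(** The point [l / 2] is the midpoint of [l - u n] and [u n], both of which are
    in [V] for large [n].  In this way open convex sets can take the
    place of closed ones in the passage to a limit. *)
Lemma convex_limit V (u : nat -> T) l : convex_comb_closed V -> nbhs 0 V ->
  (\forall n \near \oo, V (u n)) -> u @ \oo --> l -> V (2^-1 *: l).
Proof.
move=> cV nV Vu ul.
have : (fun n => l - u n) @ \oo --> l - l.
  by apply: cvg_sub; [exact: cvg_cst|exact: ul].
rewrite subrr => /(_ V nV) lu.
near \oo => n.
rewrite -[l in _ *: l](subrK (u n)) scalerDr; apply: cV => //; try lra.
  by near: n.
by near: n.
Unshelve. all: end_near. Qed.

Lemma nbhs0_split W : nbhs (0 : T) W ->
  exists2 V, nbhs (0 : T) V & forall x y, V x -> V y -> W (x - y).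
Proof.
move=> nW; have := @sub_continuous T (0, 0) W.
rewrite /= subrr => /(_ nW)[[A B] [/= nA nB] AB].
exists (A `&` B); first exact: filterI.
by move=> x y [Ax _] [_ By]; exact: (AB (x, y)).
Qed.

End Convexity.

Section Riemann.
Variables (R : realType) (T : tvsType R).
Implicit Types (c d : R -> T) (V W : set T).

Definition riemann c n : T := n%:R^-1 *: \sum_(0 <= i < n) c (i%:R / n%:R).

Definition continuous01 (S : topologicalType) (c : R -> S) : Prop :=
  forall s : R, 0 <= s <= 1 -> {for (s : R^o), continuous (c : R^o -> S)}.

Definition oscillates_in c V (m : R) := forall s s', 0 <= s <= 1 ->
  0 <= s' <= 1 -> `|s - s'| <= m -> V (c s - c s').

Lemma uniformly_continuous01 c V : continuous01 c -> nbhs 0 V ->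
  \forall n \near \oo, oscillates_in c V n.+1%:R^-1.
Proof.
move=> cc nV.
have /compact_near_coveringP cK := @segment_compact R 0 1.
pose P (n : nat) (s : R) := forall s' : R, 0 <= s' <= 1 ->
  `|s - s'| <= n.+1%:R^-1 -> V (c s - c s').
suff : \forall n \near \oo, `[0, 1]%classic `<=` P n.
  apply: filterS => n hn s s' s01 s'01 ss'.
  by apply: (hn s) => //; rewrite /= in_itv/=.
apply: cK => x; rewrite /= in_itv/= => x01.
have := @sub_continuous T (c x, c x) V.
rewrite /= subrr => /(_ nV)[[A B] [/= nA nB] AB].
have /nbhs_ballP[e /= e0 eA] := cc x x01 A nA.
have /nbhs_ballP[e' /= e'0 eB] := cc x x01 B nB.
have e'20 : 0 < e' / 2 by rewrite divr_gt0.
near=> s n => s' s'01 ss'; apply: (AB (c s, c s')); split=> /=.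
  apply: eA; near: s; apply: nbhsx_ballx.
  exact: e0.
apply: eB; rewrite -ball_normE/=.
have xs : `|x - s| < e' / 2.
  near: s.
  by apply: filterS (nbhsx_ballx (x : R^o) _ e'20) => y; rewrite -ball_normE.
have nn : n.+1%:R^-1 < e' / 2.
  by near: n; exact: near_infty_natSinv_lt (PosNum e'20).
rewrite -(subrK s x) -addrA; apply: le_lt_trans (ler_normD _ _) _.
have ss2 := le_lt_trans ss' nn; lra.
Unshelve. all: end_near. Qed.

Lemma fraction01 (i n : nat) : (i <= n)%N -> (0 < n)%N ->
  0 <= (i%:R / n%:R : R) <= 1.
Proof.
move=> i_n n0; rewrite divr_ge0//= ler_pdivrMr ?ltr0n// mul1r ler_nat.
exact: i_n.
Qed.

(** Both sums are averages over the [m * n] points of the finer subdivision, once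
    each value of [c] in the coarser one is repeated [n] times.  So their
    difference is an average of differences of values at points at distance at
    most [1 / m]. *)
Lemma riemann_refine c V m n : convex_comb_closed V -> (0 < m)%N -> (0 < n)%N ->
  oscillates_in c V m%:R^-1 -> V (riemann c m - riemann c (m * n)).
Proof.
move=> cV m0 n0 oc; have mn0 : (0 < m * n)%N by rewrite muln_gt0 m0.
have m0' : (m%:R : R) != 0 by rewrite pnatr_eq0 -lt0n.
have n0' : (n%:R : R) != 0 by rewrite pnatr_eq0 -lt0n.
have -> : riemann c m = (m * n)%:R^-1 *:
    \sum_(0 <= k < m * n) c ((k %/ n)%:R / m%:R).
  rewrite big_nat_mul /riemann.
  under [in RHS]eq_bigr => i _.
    under eq_big_nat => j /andP[ij ji].
      have -> : (j %/ n = i)%N.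
        by apply/eqP; rewrite eqn_leq leq_divRL// ij andbT -ltnS ltn_divLR.
      over.
    rewrite sumr_const_nat mulSn addnK -scaler_nat.
    over.
  by rewrite -scaler_sumr scalerA natrM invfM mulfVK.
rewrite /riemann -scalerBr -sumrB.
apply: (convex_average (v := fun k =>
  c ((k %/ n)%:R / m%:R) - c (k%:R / (m * n)%:R))) => // k kmn.
have qm : (k %/ n < m)%N by rewrite ltn_divLR.
apply: oc.
- by apply: fraction01 => //; exact: ltnW.
- by apply: fraction01 => //; exact: ltnW.
rewrite {2}(divn_eq k n) natrD !natrM.
rewrite (_ : _ - _ = - ((k %% n)%:R / n%:R / m%:R)); last by field; rewrite m0' n0'.
rewrite normrN ger0_norm ?divr_ge0// ler_piMl ?invr_ge0//.
have : (k %% n <= n)%N by rewrite ltnW// ltn_mod.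
by move=> /fraction01 /(_ n0) /andP[].
Qed.

(** Both sums are compared with the one for the common refinement [m * n]. *)
Lemma riemann_cauchy c : continuous01 c ->
  forall V, nbhs 0 V -> \forall m & n \near \oo, V (riemann c m - riemann c n).
Proof.
move=> cc V /nbhs0_split[W nW WV].
have [V' [oV' V'0 V'W cV']] := nbhs0_convex nW.
have [N _ HN] := uniformly_continuous01 cc (open_nbhs_nbhs (conj oV' V'0)).
have H m n : (N.+1 <= m)%N -> (N.+1 <= n)%N ->
    W (riemann c m - riemann c (m * n)).
  case: m => // m; case: n => // n Nm Nn; apply: V'W; apply: riemann_refine => //.
  exact: HN.
exists ([set m | (N.+1 <= m)%N], [set n | (N.+1 <= n)%N]).
  by split; exists N.+1.
move=> [m n]/= [Nm Nn]; have := WV _ _ (H m n Nm Nn) (H n m Nn Nm).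
by rewrite mulnC opprB addrA subrK.
Qed.

Lemma subACA (V : zmodType) (x y z t : V) :
  x - y - (z - t) = x - z - (y - t).
Proof. by rewrite !opprB addrACA [RHS]addrACA [- y - z]addrC. Qed.

(** The mean value inequality.  Call an interval good if its mean slope is in
    [V].  By convexity two adjacent good intervals form a good one, and since
    [V] is open every point has a neighbourhood in which the intervals around
    that point are good.  So the supremum of the right ends of the good
    intervals that start at [a] is attained, and cannot be less than [b]. *)
Lemma mean_value_convex (phi dphi : R -> T) V (a b : R) : a < b ->
  open V -> convex_comb_closed V ->
  (forall s, a <= s <= b -> V (dphi s)) ->
  (forall s, a <= s <= b ->
    (fun h => h^-1 *: (phi (s + h) - phi s)) @ (0 : R)^' --> dphi s) ->
  V ((b - a)^-1 *: (phi b - phi a)).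
Proof.
move=> ab oV cV Vd dphiE.
pose P x y := V ((y - x)^-1 *: (phi y - phi x)).
have Pjoin x y z : x < y -> y < z -> P x y -> P y z -> P x z.
  move=> xy yz Pxy Pyz; rewrite /P.
  have zx : z - x != 0 by apply/eqP; lra.
  have yx : y - x != 0 by apply/eqP; lra.
  have zy : z - y != 0 by apply/eqP; lra.
  rewrite (_ : _ *: _ = ((y - x) / (z - x)) *: ((y - x)^-1 *: (phi y - phi x)) +
      ((z - y) / (z - x)) *: ((z - y)^-1 *: (phi z - phi y))).
    apply: cV => //.
    - by rewrite divr_ge0//; lra.
    - by rewrite divr_ge0//; lra.
    - by rewrite -mulrDl (_ : y - x + (z - y) = z - x) ?divff//; ring.
  rewrite !scalerA !(mulrAC _ (z - x)^-1) !divff// !mul1r -scalerDr.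
  by congr (_ *: _); rewrite [RHS]addrC addrA subrK.
have Ploc s : a <= s <= b -> exists2 e, 0 < e & forall x y,
    s - e < x -> x <= s -> s <= y -> y < s + e -> x < y -> P x y.
  move=> sab; have := dphiE s sab V.
  move=> /(_ (open_nbhs_nbhs (conj oV (Vd s sab)))).
  move=> /nbhs_ballP[e /= e0 eV]; exists e => //.
  have R1 y : s < y -> y < s + e -> P s y.
    move=> sy ye; have := eV (y - s).
    rewrite -ball_normE/= sub0r normrN gtr0_norm; last lra.
    rewrite subrKC; apply; first lra.
    by apply/eqP; lra.
  have L1 x : s - e < x -> x < s -> P x s.
    move=> ex xs; have := eV (x - s).
    rewrite -ball_normE/= sub0r normrN ltr0_norm; last lra.
    rewrite subrKC => H; rewrite /P -(opprB x s) invrN -(opprB (phi x)).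
    by rewrite scalerN scaleNr opprK; apply: H; [lra|apply/eqP; lra].
  move=> x y ex xs sy ye xy.
  have [sx|sx] := eqVneq s x; first by rewrite -sx; apply: R1 => //; lra.
  have [sy'|sy'] := eqVneq s y; first by rewrite -sy'; apply: L1 => //; lra.
  have xs' : x < s by rewrite lt_neqAle eq_sym sx.
  have sy2 : s < y by rewrite lt_neqAle sy'.
  by apply: (Pjoin x s y) => //; [exact: L1|exact: R1].
pose S := [set t | a < t <= b /\ P a t].
have aab : a <= a <= b by lra.
have [e0 e00 He0] := Ploc a aab.
have S0 : S !=set0.
  exists (Num.min b (a + e0 / 2)); rewrite /S /=.
  have m1 : a < Num.min b (a + e0 / 2) by rewrite lt_min ab/=; lra.
  have m2 : Num.min b (a + e0 / 2) <= b by rewrite ge_min lexx.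
  have m3 : Num.min b (a + e0 / 2) <= a + e0 / 2 by rewrite ge_min lexx orbT.
  by split; [rewrite m1 m2|apply: He0 => //; lra].
have ubS : ubound S b by move=> t [/andP[]].
have hS : has_sup S by split=> //; exists b.
have asup : a < sup S.
  have [t [/andP[at_ tb] Pt]] := S0.
  by apply: (lt_le_trans at_); apply: sup_upper_bound => //; rewrite /S /= at_ tb.
have supb : sup S <= b by apply: ge_sup.
have [e e_0 He] : exists2 e, 0 < e & forall x y,
    sup S - e < x -> x <= sup S -> sup S <= y -> y < sup S + e -> x < y -> P x y.
  by apply: Ploc; rewrite (ltW asup).
have PS : P a (sup S).
  have [t [/andP[at_ tb] Pt] et] := sup_adherent e_0 hS.
  have ts : t <= sup S by apply: sup_upper_bound => //; rewrite /S /= at_ tb.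
  have [<-//|tns] := eqVneq t (sup S).
  have ts' : t < sup S by rewrite lt_neqAle tns.
  by apply: (Pjoin a t) => //; apply: He => //; lra.
have [<-//|sb] := eqVneq (sup S) b.
have sb' : sup S < b by rewrite lt_neqAle sb.
pose y := Num.min b (sup S + e / 2).
have m1 : sup S < y by rewrite lt_min sb'/=; lra.
have m2 : y <= b by rewrite ge_min lexx.
have m3 : y <= sup S + e / 2 by rewrite ge_min lexx orbT.
have : y <= sup S.
  apply: sup_upper_bound => //; split; first by rewrite m2 andbT; lra.
  by apply: (Pjoin a (sup S)) => //; apply: He => //; lra.
by rewrite leNgt m1.
Qed.

(** The fundamental theorem of calculus.  On each interval of the subdivision
    the mean slope of [gamma] differs from the value of [d] at the left end by
    an element of [V], by the mean value inequality for [gamma] minus the linear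
    map with slope [d a]; the total error is the average of these. *)
Lemma riemann_derivative (gamma d : R -> T) : continuous01 d ->
  (forall s, 0 <= s <= 1 ->
    (fun h => h^-1 *: (gamma (s + h) - gamma s)) @ (0 : R)^' --> d s) ->
  riemann d @ \oo --> gamma 1 - gamma 0.
Proof.
move=> cd dE W nW.
have : nbhs 0 [set x | W (gamma 1 - gamma 0 - x)].
  have := @sub_continuous T (gamma 1 - gamma 0, 0) W.
  rewrite /= subr0 => /(_ nW)[[A B] [/= nA nB] AB].
  by apply: filterS nB => x Bx; apply: (AB (_, x)); split=> //; exact: nbhs_singleton.
move=> /nbhs0_convex[V [oV V0 VW cV]].
have [N _ HN] := uniformly_continuous01 cd (open_nbhs_nbhs (conj oV V0)).
exists N.+1 => //= n; case: n => // n Nn.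
rewrite /= -[riemann d _](subKr (gamma 1 - gamma 0)); apply: VW.
have n0 : (n.+1%:R : R) != 0 by rewrite pnatr_eq0.
have -> : gamma 1 - gamma 0 = n.+1%:R^-1 *: \sum_(0 <= i < n.+1)
    (n.+1%:R *: (gamma (i.+1%:R / n.+1%:R) - gamma (i%:R / n.+1%:R))).
  rewrite -scaler_sumr scalerA mulVf// scale1r.
  by rewrite (telescope_sumr (fun i => gamma (i%:R / n.+1%:R)))// divff// mul0r.
rewrite /riemann -scalerBr -sumrB.
pose v i := n.+1%:R *: (gamma (i.+1%:R / n.+1%:R) - gamma (i%:R / n.+1%:R)) -
  d (i%:R / n.+1%:R).
apply: (convex_average (v := v)) => // i ilt.
rewrite {}/v; set a := i%:R / n.+1%:R; set b := i.+1%:R / n.+1%:R.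
have ba : b - a = n.+1%:R^-1 by rewrite /a /b -mulrBl -natrB// subSnn mul1r.
have nV0 : 0 < n.+1%:R^-1 :> R by rewrite invr_gt0.
have /andP[a0 a1] : 0 <= a <= 1 by exact: fraction01 (ltnW ilt) isT.
have /andP[b0 b1] : 0 <= b <= 1 by exact: fraction01 ilt isT.
clearbody a b.
have := @mean_value_convex (fun s => gamma s - s *: d a) (fun s => d s - d a) V a b.
have -> : (b - a)^-1 *: (gamma b - b *: d a - (gamma a - a *: d a)) =
   n.+1%:R *: (gamma b - gamma a) - d a.
  by rewrite subACA -scalerBl ba invrK scalerBr scalerA divff// scale1r.
apply => //.
- by rewrite -subr_gt0 ba.
- move=> s /andP[as_ sb]; apply: (HN n) => //; [lra|lra|].
  by rewrite ger0_norm ?subr_ge0// -ba lerD2r.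
- move=> s /andP[as_ sb].
  have s01 : 0 <= s <= 1 by apply/andP; split; lra.
  have h0 : \forall h \near (0 : R)^', h^-1 *: (gamma (s + h) - gamma s) - d a =
      h^-1 *: (gamma (s + h) - (s + h) *: d a - (gamma s - s *: d a)).
    near=> h.
    have hn0 : h != 0 by near: h; exact: nbhs_dnbhs_neq.
    by rewrite subACA -scalerBl [s + h]addrC addrK [RHS]scalerBr scalerA mulVf// scale1r.
  apply: (cvg_trans (near_eq_cvg h0)).
  apply: (cvg_comp (fun h => (h^-1 *: (gamma (s + h) - gamma s), d a))
    (fun z : T * T => z.1 - z.2) _ (@sub_continuous T (d s, d a))).
  by apply: cvg_pair; [exact: dE|exact: cvg_cst].
Unshelve. all: end_near. Qed.

End Riemann.

(** * The integral in a Seip-convenient space *)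

Section Integral.
Variable R : realType.
Implicit Types A F : preTopologicalLmodType R.

(** Where part of the segment over [a] is missing from the domain of [g] there is
    no value at all: with this convention the integral of the quotient has
    exactly the domain required of a quotient in [bgn_pintegral]. *)
Definition pintegral A F (I : (R -> F) -> F) (g : kprod A R^o -> option F)
    (a : A) : option F :=
  if `[< forall s : R, 0 <= s <= 1 -> pdom g (a, s) >]
  then Some (I (fun s => odflt 0 (g (a, s)))) else None.

Lemma continuous_kslice A (a : A) : continuous (fun s : R^o => (a, s) : kprod A R^o).
Proof.
apply: continuous_kpair; first exact: compactly_generated_R.
- by move=> s; exact: cvg_cst.
- by move=> s; exact: cvg_id.
Qed.

Lemma pintegrand_continuous A F (g : kprod A R^o -> option F) a :
  pcontinuous g -> (forall s : R, 0 <= s <= 1 -> pdom g (a, s)) ->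
  continuous01 (fun s => odflt 0 (g (a, s))).
Proof.
move=> cg ga s s01; have [y gy] := pdom_some (ga s s01).
have cs := pcontinuous_precomp (@continuous_kslice A a) cg.
exact: (pcontinuous_at (t0 := 0) (x := s) cs gy).
Qed.

(** The operator [I] is the integral over [0, 1], given by limits of Riemann
    sums for the underlying locally convex topology [T], where sequential
    completeness provides them.  The three properties are its linearity, the
    fundamental theorem of calculus, and continuous dependence on parameters.
    The last is first proved for [T] on the target and then lifted to the
    Kelleyfication. *)
Lemma scgVS_integral F : scgVS F -> exists I : (R -> F) -> F,
  [/\ forall c1 c2 d t, continuous01 c1 -> continuous01 c2 -> continuous01 d ->
        (forall s, 0 <= s <= 1 -> c1 s - c2 s = t *: d s) ->
        I c1 - I c2 = t *: I d,
      forall gamma d, continuous01 d -> (forall s, 0 <= s <= 1 ->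
          (fun h => h^-1 *: (gamma (s + h) - gamma s)) @ (0 : R)^' --> d s) ->
        gamma 1 - gamma 0 = I d &
      forall A (g : kprod A R^o -> option F), compactly_generated A ->
        pcontinuous g -> pcontinuous (pintegral I g)].
Proof.
move=> [cF [tau]] /= [lU hU qU kU].
pose T : tvsType R := lcs_tvs lU.
have oTF (V : set F) : @open T V -> open V by rewrite kU; exact: open_kopen.
have nTF (x : F) (V : set F) : @nbhs T T x V -> nbhs x V.
  by rewrite !nbhsE => -[B [oB Bx] BV]; exists B => //; split=> //; exact: oTF.
have cTF (c : R -> F) : continuous01 c -> @continuous01 R T c.
  by move=> cc s s01 V /nTF; exact: cc.
pose I (c : R -> F) : F := xget 0 [set l : T | riemann (c : R -> T) @ \oo --> l].
have Icvg (c : R -> F) : continuous01 c -> riemann (c : R -> T) @ \oo --> (I c : T).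
  move=> /cTF cc; rewrite /I; case: xgetP => [l -> //|noL].
  have [l cl] := qU _ (riemann_cauchy cc).
  by have := noL l.
have Iuniq (c : R -> F) (l : T) : continuous01 c ->
    riemann (c : R -> T) @ \oo --> l -> I c = l.
  by move=> /Icvg cI cl; exact: (cvg_unique hU cI cl).
exists I; split.
- move=> c1 c2 d t cc1 cc2 cd c12.
  have h1 : (fun n => riemann (c1 : R -> T) n - riemann (c2 : R -> T) n) @ \oo -->
      ((I c1 : T) - (I c2 : T)).
    by apply: cvg_sub; exact: Icvg.
  have h2 : (fun n => t *: riemann (d : R -> T) n) @ \oo --> t *: (I d : T).
    by apply: cvg_scale; exact: Icvg.
  apply: (@cvg_unique T hU _ _ _ _ h1).
  apply: cvg_trans h2; apply: near_eq_cvg; exists 1%N => //= n n0.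
  rewrite /riemann -scalerBr -sumrB scalerA mulrC -scalerA scaler_sumr.
  congr (_ *: _); apply: eq_big_nat => i /andP[_ ilt]; rewrite c12//.
  by apply: fraction01 => //; exact: ltnW.
- move=> gamma d cd dE; apply/esym/Iuniq => //.
  apply: riemann_derivative; first exact: cTF.
  by move=> s s01 V /nTF; exact: dE.
- move=> A g cA cg.
  have cgT : @pcontinuous (kprod A R^o) T g by move=> V /oTF; exact: cg.
  suff cT : @pcontinuous A T (pintegral I g).
    by move=> V; rewrite kU; exact: (pcontinuous_kopen cA cT).
  apply/pcontinuousP => a0 y0 V; rewrite /pintegral; case: asboolP => // ga0 [<-] {y0}.
  set c0 := (X in I X) => nV.
  (* A tube around [{a0} * [0, 1]] on which the integrand stays within [V' / 2]
     of its values at [a0]; the factor 2 makes up for [convex_limit]. *)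
  have /nbhs0_convex[V' [oV' V'0 V'V cV']] := @nbhs0_translate R T (I c0) V nV.
  pose slice0 (z : kprod A R^o) := g (a0, z.2).
  have cs0 : @pcontinuous (kprod A R^o) T slice0.
    apply: (@pcontinuous_precomp _ (kprod A R^o) _ (fun z : kprod A R^o => (a0, z.2))) cgT.
    exact: (continuous_compose (@snd_continuous_kprod R A R^o) (@continuous_kslice A a0)).
  pose near2 : set (T * T) := [set z | V' (2 *: (z.1 - z.2))].
  have on2 : open near2 by exact: open_scaled_difference.
  have := pcontinuous_pair cgT cs0 on2; set W := (W in open W) => oW.
  have := @kopen_tube A R^o _ (W : set (A * R^o)) (@segment_compact R 0 1) oW.
  rewrite cA.2 => oTube.
  have : nbhs a0 [set a | forall s : R^o, `[0, 1]%classic s -> W (a, s)].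
    apply: open_nbhs_nbhs; split=> // s; rewrite /= in_itv/= => s01.
    have [y gy] := pdom_some (ga0 s s01).
    exists (y, y); first by rewrite /near2/= subrr scaler0.
    by rewrite /opair /slice0/= gy.
  apply: filterS => a /= Wa.
  have Wa' s : 0 <= s <= 1 -> pdom g (a, s) /\
      V' (2 *: (odflt 0 (g (a, s)) - odflt 0 (g (a0, s)))).
    move=> s01; have [|[y y0] V'y] := Wa s; first by rewrite /= in_itv.
    rewrite /opair /slice0/= /pdom/=; case: (g (a, s)) => [z|//].
    by case: (g (a0, s)) => [z0|//] [<- <-].
  have ga s : 0 <= s <= 1 -> pdom g (a, s) by move=> /Wa'[].
  exists (I (fun s => odflt 0 (g (a, s)))); last by rewrite asboolT.
  rewrite -[I _](subKr (I c0)) opprB; apply: V'V.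
  set c := (fun s => odflt 0 (g (a, s))).
  rewrite -[_ - _](scalerK (a := 2)) ?pnatr_eq0//.
  have cc : continuous01 c by exact: pintegrand_continuous.
  have cc0 : continuous01 c0 by exact: pintegrand_continuous.
  apply: (@convex_limit R T V' (fun n =>
    2 *: (riemann (c : R -> T) n - riemann (c0 : R -> T) n))) => //.
  + by apply: open_nbhs_nbhs.
  + exists 1%N => //= n n0.
    rewrite /riemann -scalerBr -sumrB scalerA mulrC -scalerA scaler_sumr.
    apply: (@convex_average R T V' (fun i =>
      2 *: (c (i%:R / n%:R) - c0 (i%:R / n%:R))) n cV' n0) => i ilt.
    apply: (Wa' _ _).2.
    by apply: fraction01 => //; exact: ltnW.
  + apply: cvg_scale; apply: cvg_sub; [exact (Icvg _ cc)|exact (Icvg _ cc0)].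
Qed.

End Integral.

(** * Calculus of difference quotients *)

Section DifferenceCalculus.
Variable R : realType.
Implicit Types A B C E F : preTopologicalLmodType R.

Notation qspace E := (kprod (kprod E E) R^o).

Definition is_quotient E F (f : E -> option F) (h : qspace E -> option F) : Prop :=
  (forall (x u : E) (t : R),
     pdom h (x, u, t) <-> pdom f x /\ pdom f (x + t *: u)) /\
  (forall (x u : E) (t : R) (y v : F), f x = Some y -> h (x, u, t) = Some v ->
     f (x + t *: u) = Some (y + t *: v)).

Definition scg_map E F (f : E -> option F) : Prop :=
  [/\ scgVS E, scgVS F & pcontinuous f].

(** The sequence of iterated quotients in recursive form; by uniqueness of
    quotients this is no restriction for the infinite order either. *)
Fixpoint bgn k E F (f : E -> option F) : Prop :=
  scg_map f /\
  if k is k'.+1 then exists2 h, is_quotient f h & bgn k' h else True.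

Lemma bgn_scg_map k E F (f : E -> option F) : bgn k f -> scg_map f.
Proof. by case: k => [|k] []. Qed.

Lemma bgnW k E F (f : E -> option F) : bgn k.+1 f -> bgn k f.
Proof.
elim: k E F f => [|k IH] E F f [mf [h fh bh]]; split=> //.
by exists h => //; exact: IH.
Qed.

Lemma scgVS_cg E : scgVS E -> compactly_generated E.
Proof. by move=> [[]]. Qed.
Hint Resolve scgVS_cg scgVS_kprod scgVS_R : core.

(** Affine maps [L] and their linear parts [M] are treated together: the quotient
    of [L] is [M] applied to the direction, again of this kind with linear part
    itself. *)
Lemma bgn_affine k E F (L M : E -> F) : scgVS E -> scgVS F ->
  continuous L -> continuous M ->
  (forall x u t, L (x + t *: u) = L x + t *: M u) ->
  (forall x u t, M (x + t *: u) = M x + t *: M u) ->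
  bgn k (fun x => Some (L x)).
Proof.
elim: k E F L M => [|k IH] E F L M sE sF cL cM LM MM.
  by split=> //; split=> //; exact: pcontinuous_total.
split; first by split=> //; exact: pcontinuous_total.
have cM' : continuous (fun z : qspace E => M z.1.2).
  apply: continuous_compose cM; apply: (continuous_compose (T := kprod E E)).
    exact: (@fst_continuous_kprod R (kprod E E) R^o).
  exact: snd_continuous_kprod.
exists (fun z => Some (M z.1.2)).
  by split=> // x u t y v [<-] [<-]; rewrite LM.
have sQ : scgVS (qspace E) by auto.
by apply: (IH _ _ (fun z : qspace E => M z.1.2) (fun z => M z.1.2)) => // z w t;
  exact: MM.
Qed.

Lemma bgn_cst k E F (c : F) : scgVS E -> scgVS F -> bgn k (fun _ : E => Some c).
Proof.
move=> sE sF; apply: (@bgn_affine k E F (fun=> c) (fun=> 0)) => //.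
- by move=> x; exact: cvg_cst.
- by move=> x; exact: cvg_cst.
- by move=> x u t; rewrite scaler0 addr0.
- by move=> x u t; rewrite scaler0 addr0.
Qed.

Lemma bgn_linear k E F (L : E -> F) : scgVS E -> scgVS F -> continuous L ->
  (forall x u t, L (x + t *: u) = L x + t *: L u) -> bgn k (fun x => Some (L x)).
Proof. by move=> sE sF cL LL; exact: (@bgn_affine k E F L L). Qed.

Lemma bgn_fst k E F : scgVS E -> scgVS F -> bgn k (fun z : kprod E F => Some z.1).
Proof.
move=> sE sF; apply: (@bgn_linear k (kprod E F) E fst) => //; first exact: scgVS_kprod.
exact: fst_continuous_kprod.
Qed.

Lemma bgn_snd k E F : scgVS E -> scgVS F -> bgn k (fun z : kprod E F => Some z.2).
Proof.
move=> sE sF; apply: (@bgn_linear k (kprod E F) F snd) => //; first exact: scgVS_kprod.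
exact: snd_continuous_kprod.
Qed.

Lemma pcontinuous_kpair A B C (f : A -> option B) (g : A -> option C) :
  compactly_generated A -> pcontinuous f -> pcontinuous g ->
  @pcontinuous A (kprod B C) (opair f g).
Proof.
move=> cA cf cg V; exact: (pcontinuous_kopen cA (pcontinuous_pair cf cg)).
Qed.

Lemma bgn_pair k A B C (f : A -> option B) (g : A -> option C) :
  bgn k f -> bgn k g -> @bgn k A (kprod B C) (opair f g).
Proof.
elim: k A B C f g => [|k IH] A B C f g.
  move=> [[sA sB cf] _] [[_ sC cg] _]; split=> //; split=> //; first exact: scgVS_kprod.
  by apply: pcontinuous_kpair => //; exact: scgVS_cg.
move=> [[sA sB cf] [hf [fdom feq] bf]] [[_ sC cg] [hg [gdom geq] bg]]; split.
  split=> //; first exact: scgVS_kprod.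
  by apply: pcontinuous_kpair => //; exact: scgVS_cg.
exists (opair hf hg); last exact: IH.
split=> x u t.
  have := fdom x u t; have := gdom x u t; rewrite /pdom/opair/=.
  case: (hf _) => [?|]; case: (hg _) => [?|];
    case: (f x) => [?|]; case: (g x) => [?|];
    case: (f (x + _)) => [?|]; case: (g (x + _)) => [?|] //=; by intuition.
move=> [y y'] [v v']; rewrite /opair.
case fx: (f x) => [y1|//]; case gx: (g x) => [y2|//] [<- <-].
case hfx: (hf _) => [v1|//]; case hgx: (hg _) => [v2|//] [<- <-].
by rewrite (feq _ _ _ _ _ fx hfx) (geq _ _ _ _ _ gx hgx).
Qed.

(** The chain rule: the quotient of [g] after [f] at [(x, u, t)] is the quotient
    of [g] at [(f x, v, t)], where [v] is the quotient of [f] at [(x, u, t)].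
    The domains agree exactly because [f x + t *: v = f (x + t *: u)]. *)
Lemma bgn_comp k A B C (f : A -> option B) (g : B -> option C) :
  bgn k f -> bgn k g -> bgn k (fun x => obind g (f x)).
Proof.
elim: k A B C f g => [|k IH] A B C f g.
  move=> [[sA sB cf] _] [[_ sC cg] _]; split=> //; split=> //.
  exact: pcontinuous_comp.
move=> bf bg; have bfk := bgnW bf; have bgk := bgnW bg.
move: bf bg => [[sA sB cf] [hf [fdom feq] bhf]] [[_ sC cg] [hg [gdom geq] bhg]].
split; first by split=> //; exact: pcontinuous_comp.
pose phi0 : qspace A -> option (kprod B B) :=
  opair (fun z : qspace A => obind f (obind (fun p => Some p.1) (Some z.1))) hf.
pose phi : qspace A -> option (qspace B) := opair phi0 (fun z => Some z.2).
have sAA := scgVS_kprod sA sA.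
exists (fun z => obind hg (phi z)).
  split=> x u t.
    have := fdom x u t; rewrite /phi /phi0 /opair /pdom/=.
    case fx: (f x) => [y|]; last by case: (hf _) => /=; intuition.
    case hfx: (hf _) => [v|].
      have fx' := feq _ _ _ _ _ fx hfx.
      by move=> _; rewrite fx'/=; exact: gdom.
    case: (f (x + _)) => [y'|]/=; last by intuition.
    by move=> [_] /(_ (conj isT isT)).
  move=> y v; rewrite /phi /phi0 /opair/=; case fx: (f x) => [y1|//]/= gy1.
  case hfx: (hf _) => [v1|//]/= hgx.
  by rewrite (feq _ _ _ _ _ fx hfx)/= (geq _ _ _ _ _ gy1 hgx).
have bphi0 : bgn k phi0.
  apply: bgn_pair => //.
  apply: (IH _ _ _ (fun z : qspace A => obind (fun p => Some p.1) (Some z.1)) f) => //.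
  apply: (IH _ _ _ (fun z : qspace A => Some z.1) (fun p : kprod A A => Some p.1)).
    by apply: bgn_fst => //; exact: scgVS_R.
  exact: bgn_fst.
apply: (IH _ _ _ phi hg) => //.
apply: bgn_pair => //.
by apply: bgn_snd => //; exact: scgVS_R.
Qed.

Lemma bgn_tcomp k A B C (f : A -> B) (g : B -> C) :
  bgn k (fun x => Some (f x)) -> bgn k (fun y => Some (g y)) ->
  bgn k (fun x => Some (g (f x))).
Proof. by move=> bf bg; exact: (bgn_comp bf bg). Qed.

Lemma bgn_tpair k A B C (f : A -> B) (g : A -> C) :
  bgn k (fun x => Some (f x)) -> bgn k (fun x => Some (g x)) ->
  bgn k (fun x => Some ((f x, g x) : kprod B C)).
Proof. by move=> bf bg; exact: (bgn_pair bf bg). Qed.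

Lemma bgn_precomp k A B C (f : A -> B) (g : B -> option C) :
  bgn k (fun x => Some (f x)) -> bgn k g -> bgn k (fun x => g (f x)).
Proof. by move=> bf bg; exact: (bgn_comp bf bg). Qed.

Lemma bgn_id k A : scgVS A -> bgn k (fun x : A => Some x).
Proof. by move=> sA; apply: (@bgn_linear k A A id) => // x; exact: cvg_id. Qed.

Lemma bgn_tadd k A B (f g : A -> B) : bgn k (fun x => Some (f x)) ->
  bgn k (fun x => Some (g x)) -> bgn k (fun x => Some (f x + g x)).
Proof.
move=> bf bg; have [_ sB _] := bgn_scg_map bf.
apply: (bgn_tcomp (bgn_tpair bf bg) (g := fun z : kprod B B => z.1 + z.2)).
apply: bgn_linear => //; first exact: scgVS_kprod.
  by case: sB => [[]].
by move=> x u t /=; rewrite scalerDr addrACA.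
Qed.

(** The quotient of scalar multiplication at [((r, y), (s, z), t)] is
    [(r + t * s) *: z + s *: y], built from multiplications on [R] and [E]. *)
Lemma bgn_scale k E : scgVS E -> bgn k (fun z : kprod R^o E => Some (z.1 *: z.2)).
Proof.
elim: k E => [|k IH] E sE; split=> //.
- split=> //; first exact: scgVS_kprod.
  apply: pcontinuous_total; apply/continuousP => V oV; apply: open_kopen.
  by apply: (continuousP _).1 oV; case: sE => [[]].
- by have [] := bgn_scg_map (IH E sE).
have sRE := scgVS_kprod (scgVS_R R) sE.
have sRE2 := scgVS_kprod sRE sRE.
have b1 := @bgn_fst k _ _ sRE2 (scgVS_R R).
have b2 := @bgn_snd k _ _ sRE2 (scgVS_R R).
have b11 := bgn_tcomp b1 (@bgn_fst k _ _ sRE sRE).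
have b12 := bgn_tcomp b1 (@bgn_snd k _ _ sRE sRE).
have br := bgn_tcomp b11 (@bgn_fst k _ _ (scgVS_R R) sE).
have by_ := bgn_tcomp b11 (@bgn_snd k _ _ (scgVS_R R) sE).
have bs := bgn_tcomp b12 (@bgn_fst k _ _ (scgVS_R R) sE).
have bz := bgn_tcomp b12 (@bgn_snd k _ _ (scgVS_R R) sE).
exists (fun z : qspace (kprod R^o E) =>
    Some ((z.1.1.1 + z.2 *: z.1.2.1) *: z.1.2.2 + z.1.2.1 *: z.1.1.2)).
  split=> // -[r y] [s z] t /= _ _ [<-] [<-]; congr Some.
  rewrite scalerDr [X in X + _]scalerDl -addrA; congr (_ + _).
  by rewrite addrC scalerDr !scalerA (mulrC t).
apply: bgn_tadd.
  have bts := bgn_tcomp (bgn_tpair b2 bs) (IH _ (scgVS_R R)).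
  exact: (bgn_tcomp (bgn_tpair (bgn_tadd br bts) bz) (IH _ sE)).
exact: (bgn_tcomp (bgn_tpair bs by_) (IH _ sE)).
Qed.

Lemma bgn_tscale k A E (f : A -> R^o) (g : A -> E) :
  bgn k (fun x => Some (f x)) -> bgn k (fun x => Some (g x)) ->
  bgn k (fun x => Some (f x *: g x)).
Proof.
move=> bf bg; have [_ sE _] := bgn_scg_map bg.
exact: (bgn_tcomp (bgn_tpair bf bg) (bgn_scale k sE)).
Qed.

Definition pinv (r : R^o) : option R^o := if r == 0 then None else Some r^-1.

(** From [(r + t * s)^-1 - r^-1 = - t * s * r^-1 * (r + t * s)^-1] the quotient of
    the inversion is a polynomial in values of the inversion itself. *)
Lemma bgn_inv k : bgn k pinv.
Proof.
have mI : scg_map pinv.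
  split=> //; apply/pcontinuousP => r y V; rewrite /pinv.
  case: eqP => // /eqP r0 [<-] nV.
  have nI : nbhs (r : R^o) [set x : R^o | V (x^-1)] by exact: inv_continuous.
  have n0 : nbhs (r : R^o) (~` [set 0 : R^o]).
    apply: open_nbhs_nbhs; split; last by move=> /= r00; rewrite r00 eqxx in r0.
    rewrite openC; apply: compact_closed; last exact: compact_set1.
    exact: (compactly_generated_R R).1.
  apply: filterS2 nI n0 => x Vx /= /eqP x0; exists x^-1 => //.
  by rewrite (negbTE x0).
elim: k => [|k IH]; split=> //.
have sR := scgVS_R R; have sRR := scgVS_kprod sR sR.
have b1 := @bgn_fst k _ _ sRR sR.
have b2 := @bgn_snd k _ _ sRR sR.
have b11 := bgn_tcomp b1 (@bgn_fst k _ _ sR sR).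
have b12 := bgn_tcomp b1 (@bgn_snd k _ _ sR sR).
have bi := bgn_precomp b11 IH.
have bi' := bgn_precomp (bgn_tadd b11 (bgn_tscale b2 b12)) IH.
have m1 := @bgn_cst k (qspace R^o) R^o (-1) (scgVS_kprod sRR sR) sR.
exists (fun z : qspace R^o =>
  obind (fun p : qspace R^o => Some ((-1) *: (p.2 *: (p.1.1 *: p.1.2)) : R^o))
    (opair (opair (fun z : qspace R^o => pinv z.1.1)
                  (fun z : qspace R^o => pinv (z.1.1 + z.2 *: z.1.2)))
       (fun z : qspace R^o => Some z.1.2) z)).
  split=> r s t; rewrite /pdom /opair /pinv/=.
    by case: eqP => //= _; case: eqP => //=; intuition.
  move=> y v; case: eqP => // /eqP r0 [<-] /=; case: eqP => // /eqP rt0 /= [<-].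
  congr Some; rewrite /GRing.scale/= in rt0 *.
  by field; rewrite r0 rt0.
apply: (bgn_comp (bgn_pair (bgn_pair bi bi') b12)).
exact: (bgn_tscale m1 (bgn_tscale b2 (bgn_tscale b11 b12))).
Qed.

Definition endpoint E (z : qspace E) : E := z.1.1 + z.2 *: z.1.2.

Lemma bgn_endpoint k E : scgVS E -> bgn k (fun z : qspace E => Some (endpoint z)).
Proof.
move=> sE; have sEE := scgVS_kprod sE sE; have sR := scgVS_R R.
have b1 := @bgn_fst k _ _ sEE sR.
have b2 := @bgn_snd k _ _ sEE sR.
exact: (bgn_tadd (bgn_tcomp b1 (@bgn_fst k _ _ sE sE))
  (bgn_tscale b2 (bgn_tcomp b1 (@bgn_snd k _ _ sE sE)))).
Qed.

(** The difference quotient away from [t = 0], written as a composition of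
    operations which preserve differentiability. *)
Definition secant E F (f : E -> option F) (z : qspace E) : option F :=
  obind (fun p : kprod R^o (kprod F F) => Some (p.1 *: (p.2.2 + (-1) *: p.2.1)))
    (opair (fun z : qspace E => pinv z.2)
      (opair (fun z : qspace E => f z.1.1) (fun z : qspace E => f (endpoint z))) z).

Lemma bgn_secant k E F (f : E -> option F) : bgn k f -> bgn k (secant f).
Proof.
move=> bf; have [sE sF _] := bgn_scg_map bf.
have sEE := scgVS_kprod sE sE; have sR := scgVS_R R.
have sFF := scgVS_kprod sF sF.
have b1 := bgn_tcomp (@bgn_fst k _ _ sEE sR) (@bgn_fst k _ _ sE sE).
have b2 := @bgn_snd k _ _ sEE sR.
apply: (bgn_comp (bgn_pair (bgn_precomp b2 (bgn_inv k))
  (bgn_pair (bgn_precomp b1 bf) (bgn_precomp (bgn_endpoint k sE) bf)))).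
have c1 := @bgn_fst k _ _ sR sFF.
have c2 := @bgn_snd k _ _ sR sFF.
have c21 := bgn_tcomp c2 (@bgn_fst k _ _ sF sF).
have c22 := bgn_tcomp c2 (@bgn_snd k _ _ sF sF).
have m1 := @bgn_cst k (kprod R^o (kprod F F)) R^o (-1) (scgVS_kprod sR sFF) sR.
exact: (bgn_tscale c1 (bgn_tadd c22 (bgn_tscale m1 c21))).
Qed.

Lemma secantE E F (f : E -> option F) x u t v :
  secant f (x, u, t) = Some v <-> t != 0 /\
    exists y, f x = Some y /\ f (x + t *: u) = Some (y + t *: v).
Proof.
rewrite /secant /opair /pinv /endpoint/=; case: eqVneq => [->|t0]/=.
  by split=> // -[].
case: (f x) => [y|]; last by split=> // -[_ [y []]].
case: (f _) => [y'|]/=; last by split=> // -[_ [? []]].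
split=> [[<-]|[_ [_ [[<-] [->]]]]].
  split=> //; exists y; split=> //; congr Some.
  by rewrite scalerA divff// scale1r scaleN1r addrC subrK.
by rewrite scaleN1r addrC addKr scalerA mulVf// scale1r.
Qed.

End DifferenceCalculus.

(** * The variation is the difference quotient at time zero *)

Section Variation.
Variable R : realType.
Implicit Types A B C E F : preTopologicalLmodType R.

Notation qspace E := (kprod (kprod E E) R^o).

Hint Resolve scgVS_cg scgVS_kprod scgVS_R : core.

(** The only possible difference quotient of [f], see [dquotient_unique]. *)
Definition dquotient E F (f : E -> option F) (z : qspace E) : option F :=
  if z.2 == 0 then Defs.variation f z.1 else secant f z.

Lemma line_continuous E (x u : E) : scgVS E ->
  continuous (fun t : R^o => x + t *: u).
Proof.
move=> sE; have [_ _ cs] := bgn_scg_map (bgn_endpoint 0 sE).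
have cl := continuous_kslice (a := (x, u) : kprod E E).
apply/continuousP => V oV.
have := pcontinuous_precomp cl cs oV.
congr open; apply/seteqP; split=> t /=; rewrite /endpoint/=.
  by move=> [y Vy [<-]].
by move=> Vt; exists (x + t *: u).
Qed.

Lemma near_line E F (f : E -> option F) (x u : E) : scgVS E ->
  pcontinuous f -> pdom f x -> \forall t \near (0 : R^o), pdom f (x + t *: u).
Proof.
move=> sE cf fx; have nx : nbhs (x + (0 : R) *: u) (pdom f).
  rewrite scale0r addr0; apply: open_nbhs_nbhs; split=> //.
  exact: pcontinuous_dom.
exact: (line_continuous sE nx).
Qed.

(** For [t <> 0] a difference quotient is determined by the map, so that by
    continuity its value at [t = 0] is the limit which defines the variation.
    This limit is local, which is why [h'] may belong to a restriction [f'] of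
    [f]. *)
Lemma dquotient_variation E F (f f' : E -> option F) h' x u y l :
  scgVS E -> scgVS F -> pcontinuous f -> pcontinuous f' -> pcontinuous h' ->
  (forall x y, f' x = Some y -> f x = Some y) ->
  is_quotient f' h' -> f' x = Some y -> h' (x, u, 0) = Some l ->
  Defs.variation f (x, u) = Some l.
Proof.
move=> sE sF cf cf' ch f'f [hdom heq] f'x hx.
have fx := f'f _ _ f'x.
have df'x : pdom f' x by rewrite /pdom/= f'x.
have dfx : pdom f x by rewrite /pdom/= fx.
have vl : is_variation f x u l.
  have cs := continuous_kslice (a := (x, u) : kprod E E).
  have cl := pcontinuous_at (t0 := 0) (pcontinuous_precomp cs ch) hx.
  move=> V nV.
  have nV0 : \forall t \near (0 : R^o), V (odflt 0 (h' (x, u, t))).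
    by apply: cl; rewrite /= hx.
  have nf' := near_line u sE cf' df'x.
  have : \forall t \near (0 : R), t != 0 -> pdom f (x + t *: u) ->
      V (t^-1 *: (odflt 0 (f (x + t *: u)) - odflt 0 (f x))).
    apply: filterS2 nV0 nf' => t /= Vt f't t0 _.
    have [v hv] := pdom_some ((hdom x u t).2 (conj df'x f't)).
    have := heq _ _ _ _ _ f'x hv => /f'f ->.
    by rewrite fx /= addrC addKr scalerA mulVf// scale1r; rewrite hv in Vt.
  by [].
have vex : exists l, is_variation f x u l by exists l.
rewrite /Defs.variation asboolT//=; congr Some.
case: xgetP => [l' -> vl'|/(_ l)//].
have PF : ProperFilter (within [set t : R | pdom f (x + t *: u)] (0 : R)^').
  have -> : within [set t : R | pdom f (x + t *: u)] (0 : R)^' = (0 : R)^'.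
    apply/seteqP; split=> W; last exact: cvg_within.
    rewrite /within /=.
    have nf : \forall t \near (0 : R)^', pdom f (x + t *: u).
      by apply: filterS (near_line u sE cf dfx).
    by apply: filterS2 nf => t + H; exact: H.
  exact: Proper_dnbhs_numFieldType.
exact: (cvg_unique (scgVS_cg sF).1 vl' vl).
Qed.

Lemma variation_dom E F (f : E -> option F) z :
  pdom (Defs.variation f) z -> pdom f z.1.
Proof. by rewrite /pdom /Defs.variation/=; case: asboolP => // -[]. Qed.

Lemma dquotientP E F (f : E -> option F) :
  (forall x u, pdom f x -> pdom (Defs.variation f) (x, u)) ->
  is_quotient f (dquotient f).
Proof.
move=> fv; split=> [x u t|x u t y v fx].
  rewrite {1}/pdom /= /dquotient/=; case: eqVneq => [->|t0].
    rewrite scale0r addr0; split; first by move=> /variation_dom.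
    by move=> [fx _]; exact: fv.
  split.
    move=> h; have [v /secantE[_ [y [fx fx']]]] := pdom_some (f := secant f) h.
    by rewrite /pdom/= fx fx'.
  move=> [dx dx']; have [y fx] := pdom_some dx; have [y' fx'] := pdom_some dx'.
  suff -> : secant f (x, u, t) = Some (t^-1 *: (y' - y)) by [].
  apply/secantE; split=> //; exists y; split=> //.
  by rewrite fx' scalerA divff// scale1r addrC subrK.
rewrite /dquotient/=; case: eqVneq => [->|t0 /secantE[_ [y' []]]].
  by rewrite !scale0r !addr0.
by rewrite fx => -[<-].
Qed.

Lemma dquotient_extends E F (f f' : E -> option F) h' :
  scgVS E -> scgVS F -> pcontinuous f -> pcontinuous f' -> pcontinuous h' ->
  (forall x y, f' x = Some y -> f x = Some y) -> is_quotient f' h' ->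
  forall z v, h' z = Some v -> dquotient f z = Some v.
Proof.
move=> sE sF cf cf' ch f'f q' [[x u] t] v hv.
have [dx _] : pdom f' x /\ pdom f' (x + t *: u).
  by apply: (q'.1 x u t).1; rewrite /pdom/= hv.
have [y f'x] := pdom_some dx.
rewrite /dquotient/=; case: eqVneq hv => [->|t0] hv.
  exact: (dquotient_variation sE sF cf cf' ch f'f q' f'x hv).
apply/secantE; split=> //; exists y; split; first exact: f'f.
exact/f'f/(q'.2 _ _ _ _ _ f'x hv).
Qed.

Lemma dquotient_unique E F (f : E -> option F) h :
  scgVS E -> scgVS F -> pcontinuous f -> pcontinuous h -> is_quotient f h ->
  h = dquotient f.
Proof.
move=> sE sF cf ch q; apply/funext => z.
case hz : (h z) => [v|].
  by apply/esym/(dquotient_extends sE sF cf cf ch _ q hz).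
case dz : (dquotient f z) => [v|//].
move: z hz dz => [[x u] t] hz.
have nh : ~ pdom h (x, u, t) by rewrite /pdom/= hz.
rewrite /dquotient/=; case: eqVneq hz nh => [->|t0] hz nh.
  move=> dv; exfalso; apply: nh; apply/q.1; rewrite scale0r addr0.
  suff fx : pdom f x by [].
  by apply: (@variation_dom E F f (x, u)); rewrite /pdom/= dv.
move=> /secantE[_ [y [fx fx']]]; exfalso; apply: nh; apply/q.1.
by rewrite /pdom/= fx fx'.
Qed.

(** Locality is less obvious here than for derivatives, since the difference
    quotient compares values at distant points.  But it does so only for
    [t <> 0], where it is the [secant] of a map already known to be of order
    [k]; near [t = 0] the quotients of the given restrictions cover it. *)
Lemma bgn_local k E F (f : E -> option F) : scgVS E -> scgVS F ->
  (forall x, pdom f x -> exists f', [/\ bgn k f', pdom f' x &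
     forall x y, f' x = Some y -> f x = Some y]) ->
  bgn k f.
Proof.
elim: k E F f => [|k IH] E F f sE sF Hf.
  split=> //; split=> //; apply/pcontinuousP => x y V fx nV.
  have [|f' [[[_ _ /pcontinuousP cf'] _] dx f'f]] := Hf x.
    by rewrite /pdom/= fx.
  have [y' f'x] := pdom_some dx.
  have yy : y' = y by move: (f'f _ _ f'x); rewrite fx => -[].
  rewrite yy in f'x.
  by apply: filterS (cf' _ _ _ f'x nV) => x' [z Vz /f'f fz]; exists z.
have bf : bgn k f.
  apply: IH => // x /Hf[f' [bf' f'x f'f]]; exists f'; split=> //.
  exact: bgnW.
have [_ _ cf] := bgn_scg_map bf.
have sEE := scgVS_kprod sE sE; have sR := scgVS_R R.
have sQ := scgVS_kprod sEE sR.
split=> //; exists (dquotient f).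
  apply: dquotientP => x u fx.
  have [f' [[[_ _ cf'] [h' q' bh']] f'x f'f]] := Hf x fx.
  have [_ _ ch'] := bgn_scg_map bh'.
  have [y fy] := pdom_some f'x.
  have [|l hl] := @pdom_some _ _ h' (x, u, 0).
    by apply/(q'.1 x u 0); rewrite scale0r addr0.
  by rewrite /pdom/= (dquotient_variation sE sF cf cf' ch' f'f q' fy hl).
apply: IH => // -[[x u] t] dz.
have [t0|t0] := eqVneq t 0; last first.
  exists (secant f); split; first exact: bgn_secant.
    by move: dz; rewrite /pdom/= /dquotient/= (negbTE t0).
  move=> [[x' u'] t'] y sy; rewrite /dquotient/=.
  by have /secantE[/negbTE-> _] := sy.
have fx : pdom f x.
  by move: dz; rewrite /pdom/= /dquotient/= t0 eqxx => /variation_dom.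
have [f' [[[_ _ cf'] [h' q' bh']] f'x f'f]] := Hf x fx.
have [_ _ ch'] := bgn_scg_map bh'.
exists h'; split=> //.
  by apply/(q'.1 x u t); rewrite t0 scale0r addr0.
by move=> z y; exact: (dquotient_extends sE sF cf cf' ch' f'f q').
Qed.

Lemma pintegral_dom A F (I : (R -> F) -> F) (g : kprod A R^o -> option F) a :
  pdom (pintegral I g) a <-> forall s : R, 0 <= s <= 1 -> pdom g (a, s).
Proof. by rewrite /pdom/= /pintegral; case: asboolP. Qed.

(** The quotient of the integral is the integral of the quotient in the
    direction of the parameter alone, so that the class is stable by induction
    on the order. *)
Lemma bgn_pintegral k A F (I : (R -> F) -> F) (g : kprod A R^o -> option F) :
  scgVS A ->
  (forall c1 c2 d t, continuous01 c1 -> continuous01 c2 -> continuous01 d ->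
    (forall s, 0 <= s <= 1 -> c1 s - c2 s = t *: d s) -> I c1 - I c2 = t *: I d) ->
  (forall A (g : kprod A R^o -> option F), compactly_generated A ->
    pcontinuous g -> pcontinuous (pintegral I g)) ->
  bgn k g -> bgn k (pintegral I g).
Proof.
move=> + IB Ic; elim: k A g => [|k IH] A g sA bg.
  have [_ sF cg] := bgn_scg_map bg.
  by split=> //; split=> //; apply: Ic => //; exact: scgVS_cg.
move: bg => [[sAR sF cg] [h [hdom heq] bh]].
have cI : pcontinuous (pintegral I g).
  by apply: Ic => //; exact: scgVS_cg.
split; first by split.
have sR := scgVS_R R; have sAA := scgVS_kprod sA sA.
have sQ := scgVS_kprod sAA sR.
pose arg (z : kprod (qspace A) R^o) : qspace (kprod A R^o) :=
  (((z.1.1.1, z.2), (z.1.1.2, 0)), z.1.2).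
have barg : bgn k (fun z => Some (arg z)).
  have b1 := @bgn_fst R k _ _ sQ sR.
  have b2 := @bgn_snd R k _ _ sQ sR.
  have b11 := bgn_tcomp b1 (@bgn_fst R k _ _ sAA sR).
  have b12 := bgn_tcomp b1 (@bgn_snd R k _ _ sAA sR).
  have b111 := bgn_tcomp b11 (@bgn_fst R k _ _ sA sA).
  have b112 := bgn_tcomp b11 (@bgn_snd R k _ _ sA sA).
  have b0 := @bgn_cst R k (kprod (qspace A) R^o) R^o 0 (scgVS_kprod sQ sR) sR.
  exact: (bgn_tpair (bgn_tpair (bgn_tpair b111 b2) (bgn_tpair b112 b0)) b12).
have bh' := bgn_precomp barg bh.
have [_ _ ch'] := bgn_scg_map bh'.
exists (pintegral I (fun z => h (arg z))); last exact: IH.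
have addE (a b : A) (s t : R) :
    ((a, s) : kprod A R^o) + t *: ((b, 0) : kprod A R^o) = (a + t *: b, s).
  by congr (_, _) => /=; rewrite scaler0 addr0.
split=> a b t.
  have harg s : pdom h (arg ((a, b, t), s)) <-> pdom g (a, s) /\ pdom g (a + t *: b, s).
    by rewrite -addE; exact: hdom.
  split=> [/pintegral_dom H|[/pintegral_dom H1 /pintegral_dom H2]].
    by split; apply/pintegral_dom => s /H/harg[].
  by apply/pintegral_dom => s s01; apply/harg; split; [exact: H1|exact: H2].
move=> y v; rewrite /pintegral; case: asboolP => // ga [<-]; case: asboolP => // ha [<-].
have harg s : 0 <= s <= 1 -> pdom g (a + t *: b, s).
  by move=> /ha /hdom[_]; rewrite addE.
rewrite asboolT//; congr Some.
rewrite -(IB (fun s => odflt 0 (g (a + t *: b, s))) (fun s => odflt 0 (g (a, s)))).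
- by rewrite [RHS]addrC subrK.
- exact: pintegrand_continuous.
- exact: pintegrand_continuous.
- exact: (pintegrand_continuous (g := fun z => h (arg z))).
move=> s s01; have [y1 gy] := pdom_some (ga s s01).
have [v1 hv] := pdom_some (ha s s01).
have := heq _ _ _ _ _ gy hv; rewrite addE => ->.
by rewrite gy hv /= addrC addKr.
Qed.

End Variation.

(** * Comparison of the two hierarchies *)

Section Comparison.
Variable R : realType.
Implicit Types A B C E F : preTopologicalLmodType R.

Notation qspace E := (kprod (kprod E E) R^o).

Hint Resolve scgVS_cg scgVS_kprod scgVS_R : core.

(** The sequence of iterated variations, which the map determines, in recursive
    form. *)
Fixpoint seip k E F (f : E -> option F) : Prop :=
  scg_map f /\
  if k is k'.+1 then
    (forall x u, pdom f x -> pdom (Defs.variation f) (x, u)) /\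
    seip k' (Defs.variation f)
  else True.

Lemma seipW k E F (f : E -> option F) : seip k.+1 f -> seip k f.
Proof.
elim: k E F f => [|k IH] E F f [mf [df sf]]; split=> //; split=> //.
exact: IH.
Qed.

(** The variation is the difference quotient composed with the continuous linear
    map [z |-> (z, 0)]. *)
Lemma bgn_seip k E F (f : E -> option F) : bgn k f -> seip k f.
Proof.
elim: k E F f => [|k IH] E F f; first by [].
move=> [mf [h q bh]]; split=> //.
have [sE sF cf] := mf; have [_ _ ch] := bgn_scg_map bh.
have hE := dquotient_unique sE sF cf ch q.
have vE : Defs.variation f = fun z => h (z, 0).
  by apply/funext => z; rewrite hE /dquotient/= eqxx.
split.
  by move=> x u fx; rewrite vE; apply/q.1; rewrite scale0r addr0.
rewrite vE; apply: IH; apply: bgn_precomp bh.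
have sEE := scgVS_kprod sE sE.
apply: bgn_tpair; first exact: bgn_id.
exact: (@bgn_cst R k (kprod E E) R^o 0 sEE (scgVS_R R)).
Qed.

Lemma is_variationP E F (f : E -> option F) x u l : scgVS F ->
  Defs.variation f (x, u) = Some l -> is_variation f x u l.
Proof.
move=> sF; rewrite /Defs.variation; case: asboolP => // -[/= fx [l' vl']] [<-].
by case: xgetP => [l'' -> //|/(_ l')].
Qed.

(** By induction [f] and its variation are BGN maps of order [k], and it has to be
    shown that so is the difference quotient.  This is a local question.  Away
    from [t = 0] the quotient is the [secant] of [f].  Where the segment from
    [x] to [x + t *: u] lies in the domain of [f], which includes all the points
    with [t = 0], it is the integral over [s] of the variation of [f] at
    [(x + (s * t) *: u, u)]: a parameter integral of a BGN map of order [k]. *)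
Lemma seip_bgn k E F (f : E -> option F) : seip k f -> bgn k f.
Proof.
elim: k E F f => [|k IH] E F f; first by [].
move=> sf; have bf := IH _ _ _ (seipW sf); move: sf => [mf [df sv]].
have bv := IH _ _ _ sv; have [sE sF cf] := mf.
have sR := scgVS_R R.
have sEE := scgVS_kprod sE sE; have sQ := scgVS_kprod sEE sR.
split=> //; exists (dquotient f); first exact: dquotientP.
have [I [IB IFTC Ic]] := scgVS_integral sF.
pose arg (z : kprod (qspace E) R^o) : kprod E E :=
  (z.1.1.1 + (z.2 *: z.1.2) *: z.1.1.2, z.1.1.2).
have barg : bgn k (fun z => Some (arg z)).
  have b1 := @bgn_fst R k _ _ sQ sR.
  have b2 := @bgn_snd R k _ _ sQ sR.
  have b11 := bgn_tcomp b1 (@bgn_fst R k _ _ sEE sR).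
  have b12 := bgn_tcomp b1 (@bgn_snd R k _ _ sEE sR).
  have b111 := bgn_tcomp b11 (@bgn_fst R k _ _ sE sE).
  have b112 := bgn_tcomp b11 (@bgn_snd R k _ _ sE sE).
  exact: (bgn_tpair (bgn_tadd b111 (bgn_tscale (bgn_tscale b2 b12) b112)) b112).
pose g z := Defs.variation f (arg z).
have bg : bgn k g by exact: bgn_precomp barg bv.
have [_ _ cg] := bgn_scg_map bg.
have bG := bgn_pintegral sQ IB Ic bg.
apply: bgn_local => // -[[x u] t] dz.
have [t0|t0] := eqVneq t 0; last first.
  exists (secant f); split; first exact: bgn_secant.
    by move: dz; rewrite /pdom/= /dquotient/= (negbTE t0).
  move=> [[x' u'] t'] y sy; rewrite /dquotient/=.
  by have /secantE[/negbTE-> _] := sy.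
have fx : pdom f x.
  by move: dz; rewrite /pdom/= /dquotient/= t0 eqxx => /variation_dom.
exists (pintegral I g); split=> //.
  apply/pintegral_dom => s _; rewrite /pdom/= /g /arg/= t0 scaler0 scale0r addr0.
  exact: df.
move=> {t0 dz fx x u t} [[x u] t] l Gl.
have gdom : forall s : R, 0 <= s <= 1 -> pdom g (x, u, t, s).
  by apply/(@pintegral_dom R (qspace E) F I g (x, u, t)); rewrite /pdom/= Gl.
move: Gl; rewrite /pintegral asboolT// => -[<-] {l}.
set d := fun s => _.
have cd : continuous01 d by exact: pintegrand_continuous.
have fdom s : 0 <= s <= 1 -> pdom f (x + (s * t) *: u).
  by move=> /gdom /variation_dom.
rewrite /dquotient/=; case: eqVneq => [t0|t0].
  have [|l vl] := @pdom_some _ _ (Defs.variation f) (x, u).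
    by apply: df; have := fdom 0; rewrite mul0r scale0r addr0; apply; rewrite lexx ler01.
  have dl : d = fun=> l.
    by apply/funext => s; rewrite /d /g /arg/= t0 scaler0 scale0r addr0 vl.
  rewrite vl; congr Some; rewrite -(IFTC (fun s => s *: l) d) //.
    by rewrite scale1r scale0r subr0.
  move=> s _; rewrite dl.
  have E0 : \forall h \near (0 : R)^', l = h^-1 *: ((s + h) *: l - s *: l).
    near=> h; have h0 : h != 0 by near: h; exact: nbhs_dnbhs_neq.
    by rewrite -scalerBl addrAC subrr add0r scalerA mulVf// scale1r.
  apply: (cvg_trans (near_eq_cvg E0)); exact: cvg_cst.
apply/secantE; split=> //.
have [|y fx] := @pdom_some _ _ f x.
  by have := fdom 0; rewrite mul0r scale0r addr0; apply; rewrite lexx ler01.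
have [|y' fx'] := @pdom_some _ _ f (x + t *: u).
  by have := fdom 1; rewrite mul1r; apply; rewrite lexx ler01.
exists y; split=> //; rewrite fx'; congr Some.
(* Dividing by [t] turns the derivative of [gamma] into the variation itself. *)
pose gamma s := t^-1 *: odflt 0 (f (x + (s * t) *: u)).
rewrite -(IFTC gamma d) //.
  rewrite /gamma mul1r mul0r scale0r addr0 fx fx' /= -scalerBr scalerA divff//.
  by rewrite scale1r addrC subrK.
move=> s s01; have fxs := fdom s s01.
have [l vl] := pdom_some (df _ u fxs).
have -> : d s = l by rewrite /d /g /arg/= vl.
have vl' := is_variationP sF vl.
have ht : (fun h : R => h * t) @ (0 : R)^' -->
    within [set t' : R | pdom f (x + (s * t) *: u + t' *: u)] (0 : R)^'.
  move=> W; rewrite /within /= => nW.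
  have cm (V : set R) : nbhs (0 : R) V -> \forall h \near (0 : R), V (h * t).
    by move=> nV; have := @mulrr_continuous R t 0 V; rewrite /= mul0r; apply.
  apply: filterS2 (cm _ nW) (cm _ (near_line u sE cf fxs)) => h /= Wh fh h0.
  by apply: Wh => //; rewrite mulf_neq0.
have E0 : \forall h \near (0 : R)^',
    (h * t)^-1 *: (odflt 0 (f (x + (s * t) *: u + (h * t) *: u)) -
      odflt 0 (f (x + (s * t) *: u))) = h^-1 *: (gamma (s + h) - gamma s).
  by near=> h; rewrite /gamma -scalerBr scalerA mulrDl scalerDl addrA invfM.
apply: (cvg_trans (near_eq_cvg E0)).
exact: (cvg_comp _ _ ht vl').
Unshelve. all: end_near. Qed.

Lemma D_Seip0 (ft : partial_map R) : D_Seip (Fin 0) ft <-> C0 ft.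
Proof.
split=> [[s [<- Cs _]]|Cf]; first exact: Cs.
by exists (fun=> ft); split.
Qed.

Lemma lt_smoothnessE i k : lt_smoothness i k = le_smoothness i.+1 k.
Proof. by case: k. Qed.

Lemma lt_smoothnessW i k : lt_smoothness i k -> le_smoothness i k.
Proof. by case: k => //= n /ltnW. Qed.

Lemma le_lt_smoothness i j k : le_smoothness (i + j.+1) k -> lt_smoothness i k.
Proof. by case: k => //= n; apply: leq_trans; rewrite addnS ltnS leq_addr. Qed.

Lemma D_SeipP k (ft : partial_map R) :
  D_Seip k ft <-> forall j, le_smoothness j k -> seip j (@pfun R ft).
Proof.
split=> [[s [<- Cs ds]] j|H].
  suff : forall i, le_smoothness (i + j) k -> seip j (@pfun R (s i)) by move=> /(_ 0%N).
  elim: j => [|j IH] i ijk; first by split=> //; apply: Cs; rewrite addn0 in ijk.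
  have ik := le_lt_smoothness ijk.
  have [[Ci Cv dv] sE] := ds i ik.
  split=> //; split=> //.
  have := IH i.+1; rewrite addSn -addnS => /(_ ijk).
  by rewrite sE.
have Hs i j : le_smoothness (i + j) k ->
    seip j (@pfun R (iter i (@seip_variation R) ft)).
  elim: i j => [|i IH] j; first exact: H.
  by rewrite addSn -addnS => /IH[_ []].
exists (fun i => iter i (@seip_variation R) ft); split=> //.
  by move=> i ik; have [] := Hs i 0 _; first by rewrite addn0.
move=> i ik; split=> //; have [] := Hs i 1 _; first by rewrite addn1 -lt_smoothnessE.
by move=> Ci [di [Cv _]]; split.
Qed.

(** By uniqueness of difference quotients one sequence serves for all finite
    orders, so that also the infinite order reduces to them. *)
Lemma D_BGNP k (ft : partial_map R) :
  D_BGN (@D_Seip R (Fin 0)) k ft <->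
  forall j, le_smoothness j k -> bgn j (@pfun R ft).
Proof.
split=> [[s [<- Cs ds]] j|H].
  suff : forall i, le_smoothness (i + j) k -> bgn j (@pfun R (s i)) by move=> /(_ 0%N).
  elim: j => [|j IH] i ijk.
    by split=> //; apply/D_Seip0; apply: Cs; rewrite addn0 in ijk.
  have ik := le_lt_smoothness ijk.
  have [h [sE Ch hdom heq]] := ds i ik.
  split.
    by apply/D_Seip0; exact/Cs/lt_smoothnessW.
  exists h => //.
  have := IH i.+1; rewrite addSn -addnS => /(_ ijk).
  by rewrite sE.
pose next (gt : partial_map R) := PartialMap (dquotient (@pfun R gt)).
have Hs i j : le_smoothness (i + j) k -> bgn j (@pfun R (iter i next ft)).
  elim: i j => [|i IH] j; first exact: H.
  rewrite addSn -addnS => /IH[[sE sF cf] [h q bh]].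
  have [_ _ ch] := bgn_scg_map bh.
  by rewrite /= -(dquotient_unique sE sF cf ch q).
exists (fun i => iter i next ft); split=> //.
  by move=> i ik; apply/D_Seip0; have [] := Hs i 0 _; first by rewrite addn0.
move=> i ik.
have [] := Hs i 1 _; first by rewrite addn1 -lt_smoothnessE.
move=> [sE sF cf] [h q [mh _]]; have [_ _ ch] := mh.
have hE := dquotient_unique sE sF cf ch q.
have nE : iter i.+1 next ft = PartialMap h by rewrite hE.
exists h; split=> //; last exact: q.2.
- by rewrite nE; apply/D_Seip0.
- exact: q.1.
Qed.

End Comparison.

Theorem theorem52 (R : realType) (k : smoothness) (ft : partial_map R) :
  D_Seip k ft <-> D_BGN (@D_Seip R (Fin 0)) k ft.
Proof.
split=> [/D_SeipP H|/D_BGNP H].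
  by apply/D_BGNP => j /H; exact: seip_bgn.
by apply/D_SeipP => j /H; exact: bgn_seip.
Qed.
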